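(* The subcritical GMC with a given expectation $\mu$ over a given Gaussian field $X$ is unique whenever it exists: if $M$ and $\widetilde M$ are subcritical GMCs over the same Gaussian field $X$ on $(\mathcal T,\mu)$ and $\mathbb E M=\mathbb E\widetilde M=\mu$, then $M=\widetilde M$ almost surely.
   Context: $(\mathcal T,\mu)$ is a standard measurable space with a finite positive measure, and $(\Omega,\mathcal F,\mathbb P)$ is a standard probability space. Gaussian field: fix a finite measure $\nu$ on $\mathcal T$ equivalent to $\mu$. A Gaussian field $X$ on $(\mathcal T,\mu)$ (with test functions in $L^2(\nu)$) is a bounded linear map $g\mapsto X(g)$ from $L^2(\mathcal T,\nu)$ to $L^2(\Omega,\mathbb P)$ all of whose values are centered Gaussian (hence jointly Gaussian). $\sigma(X)$ is the ($\mathbb P$-completed) $\sigma$-algebra generated by all $X(g)$. Fix a countable orthonormal basis $(g_k)$ of $L^2(\nu)$. Cameron–Martin space: let $G$ be the closed linear span of $\{X(g)\}$ in $L^2(\mathbb P)$; for $\eta\in G$ let $\xi_\eta\in L^2(\nu)$ be such that $\int\xi_\eta g\,d\nu=\mathbb E[\eta X(g)]$ for all $g\in L^2(\nu)$. $H:=\{\xi_\eta:\eta\in G\}$ is the Cameron–Martin space. Random measure: a random measure on $(\mathcal T,\mu)$ is a random positive finite measure $M$ such that $\mathbb E M\ll\mu$, where $(\mathbb E M)[A]:=\mathbb E(M[A])$. If $M$ is $\sigma(X)$-measurable, write $M=M(X)=m((X(g_k))_k)$ with $m$ measurable, and for $\xi\in H$ put $M(X+\xi):=m((X(g_k)+\int\xi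 g_k\,d\nu)_k)$, well-defined a.s. by the Cameron–Martin theorem. GMC: a Gaussian multiplicative chaos (GMC) over the field $X$ is a $\sigma(X)$-measurable random measure $M$ on $(\mathcal T,\mu)$ such that for every $\xi\in H$, $M(X+\xi,dt)=e^{\xi(t)}M(X,dt)$ almost surely. It is subcritical if $\mathbb E M$ is $\sigma$-finite. *)

(* Defs.v *)
From HB Require Import structures.
From mathcomp Require Import all_boot all_order all_algebra.
From mathcomp Require Import all_classical all_reals all_analysis.
From mathcomp Require Import measurable_realfun.

Set Implicit Arguments.
Unset Strict Implicit.
Unset Printing Implicit Defensive.
Import Order.TTheory GRing.Theory Num.Theory.
Import numFieldNormedType.Exports.

Local Open Scope classical_set_scope.
Local Open Scope ring_scope.

(* Sets equal to a member of S up to a subset of a measurable mu-null set, so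
   that for a sub-sigma-algebra S all null sets of the ambient one are added. *)
Definition completion d (T : measurableType d) (R : realType)
    (mu : set T -> \bar R) (S : set (set T)) : set (set T) :=
  [set A | exists2 B, S B & mu.-negligible (A `+` B)].

(* Standard Borel space: isomorphic to a Borel subset of the line. *)
Definition standard_measurable (R : realType) d (T : measurableType d) : Prop :=
  exists f : {mfun T >-> R},
    injective f /\ forall A, measurable A -> measurable (f @` A).

(* Standard probability space: isomorphic mod 0 to a Borel probability on the
   line, via f restricted to the conull set D.  Images of events need only be
   Borel up to null sets of the law of f, so that both standard Borel spaces
   and their completions (Lebesgue-Rokhlin spaces) are covered. *)
Definition standard_probability d (Omega : measurableType d) (R : realType)
    (P : probability Omega R) : Prop :=
  exists (D : set Omega) (f : {mfun Omega >-> R}),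
    [/\ measurable D, P D = 1%E, {in D &, injective f} &
      forall A, measurable A -> A `<=` D ->
        completion (pushforward P f) measurable (f @` A)].

(* Square-integrable functions; elements of L^2 are represented by functions,
   and equalities in L^2 are stated almost everywhere. *)
Notation L2 mu := (LfunType mu (lee1n 2)).

Section L2_spans.
Context d (T : measurableType d) (R : realType).
Variable mu : {measure set T -> \bar R}.

Definition L2norm (f : L2 mu) : \bar R := 'N[mu]_2%:E[EFin \o f].

Definition L2inner (f g : L2 mu) : R := \int[mu]_x (f x * g x).

Definition closed_span (J : Type) (F : J -> L2 mu) : set (L2 mu) :=
  [set f : L2 mu | forall e : R, 0 < e ->
    exists (n : nat) (a : 'I_n -> R) (j : 'I_n -> J),
      (L2norm (f - \sum_(i < n) a i *: F (j i))%R < e%:E)%E].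

Definition orthonormal_basis (I : eqType) (g : I -> L2 mu) : Prop :=
  (forall i j, L2inner (g i) (g j) = (i == j)%:R) /\
  closed_span g = [set: L2 mu].

End L2_spans.

(* The point mass at 0 is a (degenerate) Gaussian law; the library's
   normal_prob 0 0 is a uniform law instead. *)
Definition centered_gaussian d (Omega : measurableType d) (R : realType)
    (P : probability Omega R) (Y : {mfun Omega >-> R}) : Prop :=
  exists s : R, forall A, measurable A ->
    distribution P Y A = if s == 0 then \d_(0 : R) A else normal_prob 0 s A.

Section gaussian_field.
Context d d' (T : measurableType d) (Omega : measurableType d') (R : realType).
Variables (nu : {finite_measure set T -> \bar R}) (P : probability Omega R).

(* Linearity and boundedness force X g = X h a.e. whenever g = h a.e., so X
   does define a map between the L^2 spaces of classes. *)
Definition gaussian_field (X : L2 nu -> L2 P) : Prop :=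
  [/\ forall (a : R) g h, X (a *: g + h) = a *: X g + X h %[ae P],
      exists C : R, forall g, (L2norm (X g) <= C%:E * L2norm g)%E &
      forall g, centered_gaussian P (X g)].

Variable X : L2 nu -> L2 P.

Definition sigma_field : set (set Omega) :=
  completion P <<s \bigcup_g preimage_set_system setT (X g) measurable >>.

Definition cameron_martin : set (L2 nu) :=
  [set xi | exists2 eta, closed_span X eta &
    forall g, L2inner xi g = L2inner eta (X g)].

End gaussian_field.

(* I -> R with the sigma-algebra generated by the coordinates. *)
Definition coordinate_sets (R : realType) (I : Type) : set (set (I -> R)) :=
  \bigcup_i preimage_set_system setT (fun x : I -> R => x i) measurable.

Notation Rproduct R I := (g_sigma_algebraType (@coordinate_sets R I)).

(* A random finite measure is a measurable family of finite measures on T, that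
   is, a finite transition kernel (with no uniform bound on the total masses;
   the s-finiteness packed in R.-ftker follows from pointwise finiteness). *)
Section chaos.
Context d d' (T : measurableType d) (Omega : measurableType d') (R : realType).
Variables (P : probability Omega R) (mu : {finite_measure set T -> \bar R}).

Definition mean_measure (M : R.-ftker Omega ~> T) (A : set T) : \bar R :=
  (\int[P]_w M w A)%E.

Definition random_measure (M : R.-ftker Omega ~> T) : Prop :=
  mean_measure M `<< mu.

Variables (nu : {finite_measure set T -> \bar R}) (X : L2 nu -> L2 P).
Variables (I : countType) (g : I -> L2 nu).

Definition field_measurable (M : R.-ftker Omega ~> T) : Prop :=
  forall A, measurable A -> forall B : set (\bar R), measurable B ->
    sigma_field X ((fun w => M w A) @^-1` B).

Definition coordinates (w : Omega) : Rproduct R I := fun k => X (g k) w.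

Definition shifted_coordinates (xi : L2 nu) (w : Omega) : Rproduct R I :=
  fun k => X (g k) w + L2inner xi (g k).

(* M = m((X(g_k))_k) for a measurable map m into finite measures; then M(X + xi)
   is w |-> m (shifted_coordinates xi w).  By the Cameron-Martin theorem this
   does not depend, up to null sets, on the choice of m when xi is in H. *)
Definition functional_of_field (m : R.-ftker (Rproduct R I) ~> T)
    (M : R.-ftker Omega ~> T) : Prop :=
  {ae P, forall w, forall A, measurable A -> M w A = m (coordinates w) A}.

Definition GMC (M : R.-ftker Omega ~> T) : Prop :=
  [/\ random_measure M, field_measurable M &
    exists2 m, functional_of_field m M &
      forall xi, cameron_martin X xi ->
        {ae P, forall w, forall A, measurable A ->
          m (shifted_coordinates xi w) A =
          (\int[M w]_(t in A) (expR (xi t))%:E)%E}].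

Definition subcritical (M : R.-ftker Omega ~> T) : Prop :=
  sigma_finite setT (mean_measure M).

End chaos.

(* Main.v *)
Require Import Defs.
From HB Require Import structures.
From mathcomp Require Import all_boot all_order all_algebra.
From mathcomp Require Import all_classical all_reals all_analysis.
From mathcomp Require Import measurable_realfun ring lra.

Set Implicit Arguments.
Unset Strict Implicit.
Unset Printing Implicit Defensive.
Import Order.TTheory GRing.Theory Num.Theory.
Import numFieldNormedType.Exports.

Local Open Scope classical_set_scope.
Local Open Scope ring_scope.

(** Write [X(h)] for the Gaussian variable attached to [h], and [xi] for the
    element of the Cameron-Martin space with [<xi, f> = E[X(h) X(f)]] for all [f].
    A chaos [M] of mean [mu] satisfies, by the Cameron-Martin theorem and by its
    defining shift property,
      [E[M(A) e^(X(h) - E[X(h)^2]/2)] = E[M(X + xi)(A)]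
                                      = E[int_A e^xi dM] = int_A e^xi dmu]
    ([chaos_exponential]).  The right-hand side does not involve [M].  Hence the
    measures [M(A) P] and [M'(A) P] on [Omega] give the same integral to every
    exponential of the field, and it remains to show that these exponentials
    determine a measure on the events of the field.

    This is a question about the moment problem: log-normal variables are not
    determined by their moments, so the exponentials have to be used as a family
    indexed by all real multiples of [h].  If two measures give the same finite
    integral to [e^(a u)] for every real [a], difference quotients in [a] show that
    they give the same integral to every power of [u], hence to [cos u] and [sin u],
    whose power series are dominated by [e^|u|] ([agree_cos], [agree_sin]).  The
    trigonometric functions of a vector space [V] of measurable functions are bounded
    and closed under products up to linear combinations, so measures that agree
    on them agree on the sigma-algebra generated by [V] ([trigonometric_uniqueness]).

    Finiteness of the exponential moments requires a truncation.  The integral of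
    [e^(a xi)] over [A] may diverge; it is finite for all [a] when [xi] is
    bounded on [A].  The equality of the integrals of [cos X(h)] and [sin X(h)] is
    therefore proved on [A] intersected with [|xi| <= n], and is extended to [A]
    by letting [n] tend to infinity, which is harmless because [cos] and [sin] are
    bounded ([agree_rooted_trig]).  The truncation depends on [h], and this is why
    the passage from exponentials to trigonometric functions is made one [h] at
    a time, before the functions attached to different [h] are multiplied.

    Then [M(A) P] and [M'(A) P] coincide on the events of the field; the event
    [M(A) < M'(A)] is one of them, so it is null ([chaos_ae_le]), and by symmetry
    [M(A) = M'(A)] almost surely for each [A].  Since [T] is a standard Borel space,
    countably many sets [A] suffice to identify the two random measures
    ([measure_eq_rays]).

    Two classical facts are established on the way.  The Cameron-Martin theorem
    ([cameron_martin_shift]) is the same uniqueness principle, applied to the law of the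
    shifted coordinates and to the law of the coordinates under the exponential density.
    The existence of [xi] for every [h] is the Riesz representation theorem in
    [L^2(nu)] ([L2_riesz]), obtained by minimising a quadratic functional. *)

(** * Functions with equal integrals under two measures *)
Section agree.
Context d (S : measurableType d) (R : realType).
Variables m1 m2 : {measure set S -> \bar R}.
Implicit Types f g : S -> R.

(** Integrability under both measures is part of the relation: it makes [agree]
    a linear condition, stable under dominated limits. *)
Definition agree f : Prop :=
  [/\ m1.-integrable setT (EFin \o f), m2.-integrable setT (EFin \o f) &
      (\int[m1]_x (f x)%:E = \int[m2]_x (f x)%:E)%E].

Lemma agree_measurable f : agree f -> measurable_fun setT f.
Proof. by case=> /integrableP[/measurable_EFinP]. Qed.

Lemma agree_ge0 f (c : R) :
  (forall x, 0 <= f x) -> measurable_fun setT f ->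
  (\int[m1]_x (f x)%:E = c%:E)%E -> (\int[m2]_x (f x)%:E = c%:E)%E ->
  agree f.
Proof.
move=> f0 mf i1 i2; split; last by rewrite i1 i2.
- apply/integrableP; split; first exact/measurable_EFinP.
  under eq_integral do rewrite /= ger0_norm //.
  by rewrite i1 ltry.
- apply/integrableP; split; first exact/measurable_EFinP.
  under eq_integral do rewrite /= ger0_norm //.
  by rewrite i2 ltry.
Qed.

Lemma agreeD f g : agree f -> agree g -> agree (f \+ g).
Proof.
move=> [f1 f2 ef] [g1 g2 eg]; split.
- rewrite (_ : _ \o _ = (EFin \o f) \+ (EFin \o g))%E; last exact/funext.
  exact: integrableD.
- rewrite (_ : _ \o _ = (EFin \o f) \+ (EFin \o g))%E; last exact/funext.
  exact: integrableD.
- under eq_integral do rewrite EFinD.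
  under [RHS]eq_integral do rewrite EFinD.
  by rewrite !integralD //= ef eg.
Qed.

Lemma agreeZ (a : R) f : agree f -> agree (fun x => a * f x).
Proof.
move=> [f1 f2 ef]; split; [exact: (integrableZl measurableT a f1)|
  exact: (integrableZl measurableT a f2)|].
under eq_integral do rewrite EFinM.
under [RHS]eq_integral do rewrite EFinM.
by rewrite !integralZl //= ef.
Qed.

Lemma agree_sum (n : nat) (f : 'I_n -> S -> R) :
  (forall i, agree (f i)) -> agree (fun x => \sum_(i < n) f i x).
Proof.
move=> af; have af0 : agree (fun=> 0).
  split; try exact: integrable0.
  by rewrite !integral0_eq.
elim: n f af => [|n IH] f af.
  by rewrite (_ : (fun _ => _) = fun=> 0) //; apply/funext => x; rewrite big_ord0.
rewrite (_ : (fun _ => _) =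
  (fun x => \sum_(i < n) f (widen_ord (leqnSn n) i) x) \+ f ord_max); last first.
  by apply/funext => x /=; rewrite big_ord_recr.
by apply: agreeD => //; apply: IH.
Qed.

Lemma agree_dominated (f : nat -> S -> R) g h :
  (forall n, agree (f n)) -> agree h ->
  (forall x, f n x @[n --> \oo] --> g x) ->
  (forall n x, `|f n x| <= h x) -> agree g.
Proof.
move=> af [h1 h2 _] fg fh.
have mf n : measurable_fun setT (f n) by exact: agree_measurable.
have mg : measurable_fun setT g.
  by apply: (measurable_fun_cvg mf) => x _; exact: fg.
have cv x : setT x -> (f n x)%:E @[n --> \oo] --> (g x)%:E.
  by move=> _; apply: cvg_EFin; [exact: nearW|exact: fg].
have bd n x : setT x -> (`|(f n x)%:E| <= (EFin \o h) x)%E.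
  by move=> _; rewrite lee_fin.
have mEf n : measurable_fun setT (fun x => (f n x)%:E) by exact/measurable_EFinP.
have mEg : measurable_fun setT (fun x => (g x)%:E) by exact/measurable_EFinP.
have [i1 _ l1] := dominated_convergence measurableT mEf mEg (aeW m1 cv) h1
  (aeW m1 (fun x n tx => bd n x tx)).
have [i2 _ l2] := dominated_convergence measurableT mEf mEg (aeW m2 cv) h2
  (aeW m2 (fun x n tx => bd n x tx)).
have E : (fun n => (\int[m1]_x (f n x)%:E)%E) = (fun n => (\int[m2]_x (f n x)%:E)%E).
  by apply/funext => n; case: (af n).
by rewrite E in l1; split => //; exact: (cvg_unique _ l1 l2).
Qed.

End agree.

(** * From exponential moments to trigonometric integrals *)
Section exponential_moments.
Context (R : realType).
Implicit Types x : R.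

(** The difference quotient at [0], with step [1 / (n + 1)], of [a |-> e^(a x)].  It
    is a combination of exponentials of [x] and converges to [x]; thus its powers
    carry information on exponential moments over to ordinary moments. *)
Definition exp_quotient (n : nat) x : R := n.+1%:R * (expR (x / n.+1%:R) - 1).

Lemma ge_exp_quotient n x : x <= exp_quotient n x.
Proof.
by rewrite /exp_quotient -ler_pdivrMl // lerBrDl mulrC; exact: expR_ge1Dx.
Qed.

Lemma le_exp_quotient n x : exp_quotient n x <= x * expR (x / n.+1%:R).
Proof.
rewrite /exp_quotient -ler_pdivlMl // mulrA [_^-1 * x]mulrC.
have := expR_ge1Dx (- (x / n.+1%:R)); rewrite expRN => h.
have e0 := expR_gt0 (x / n.+1%:R).
by rewrite -(ler_pM2r e0) mulVf ?gt_eqF // mulrDl mul1r mulNr in h; rewrite lerBlDr addrC -lerBlDr.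
Qed.

Lemma cvg_exp_quotient x : exp_quotient n x @[n --> \oo] --> x.
Proof.
apply: (@squeeze_cvgr _ _ _ _ (fun=> x) (fun n => x * expR (x / n.+1%:R))).
- by apply: nearW => n; rewrite ge_exp_quotient le_exp_quotient.
- exact: cvg_cst.
- rewrite -[X in _ --> X]mulr1; apply: cvgMl_tmp.
  rewrite -[X in _ --> X]expR0; apply: continuous_cvg; first exact: continuous_expR.
  rewrite -[X in _ --> X](mulr0 x); apply: cvgMl_tmp.
  exact: cvg_harmonic.
Qed.

(** The bound is itself an exponential, uniformly in [n], so that all powers of the
    quotients have an integrable majorant as soon as exponential moments are finite. *)
Lemma exp_quotient_bound n x : `|exp_quotient n x| <= expR (2 * `|x|).
Proof.
have xe : `|x| <= expR `|x| by have := expR_ge1Dx `|x|; lra.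
have e1 : expR `|x| <= expR (2 * `|x|) by rewrite ler_expR; have := normr_ge0 x; lra.
have lo := ge_exp_quotient n x; have up := le_exp_quotient n x.
have [x0|x0] := leP 0 x.
  rewrite ger0_norm; last exact: le_trans lo.
  apply: (le_trans up); rewrite ger0_norm // in xe e1 *.
  rewrite mulr_natl mulr2n expRD ler_pM ?expR_ge0 // ler_expR.
  by rewrite ler_pdivrMr // ler_peMr // ler1n.
have : exp_quotient n x <= 0.
  by apply: (le_trans up); rewrite mulr_le0_ge0 ?expR_ge0 // ltW.
move=> q0; rewrite ler0_norm //; apply: le_trans e1; apply: le_trans xe.
by rewrite ltr0_norm // lerN2.
Qed.

Lemma cvgX (f : R ^nat) (l : R) k :
  f n @[n --> \oo] --> l -> f n ^+ k @[n --> \oo] --> l ^+ k.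
Proof.
move=> fl; elim: k => [|k IH].
  under eq_fun do rewrite expr0; exact: cvg_cst.
by under eq_fun do rewrite exprS; rewrite exprS; exact: cvgM.
Qed.

End exponential_moments.

Section laplace_uniqueness.
Context d (S : measurableType d) (R : realType).
Variables m1 m2 : {measure set S -> \bar R}.
Variable u : S -> R.
Hypothesis mgf : forall a : R, agree m1 m2 (fun x => expR (a * u x)).

Let expR_abs_le (c x : R) : 0 <= c -> expR (c * `|x|) <= expR (c * x) + expR (- c * x).
Proof.
move=> c0; have [x0|x0] := leP 0 x.
  by rewrite ger0_norm // lerDl expR_ge0.
by rewrite ltr0_norm // mulrN mulNr lerDr expR_ge0.
Qed.

(** A power of the difference quotient is a polynomial in [e^(u / (n + 1))], that is,
    a linear combination of functions [e^(a u)]. *)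
Lemma agree_exp_quotientX n k : agree m1 m2 (fun x => exp_quotient n (u x) ^+ k).
Proof.
(* The polynomial [p] with [exp_quotient n x ^+ k = p.[e^(x / (n + 1))]]. *)
pose p : {poly R} := (n.+1%:R *: ('X - 1)) ^+ k.
rewrite (_ : (fun _ => _) = fun x => \sum_(i < size p) p`_i * expR (i%:R / n.+1%:R * u x)).
  by apply: agree_sum => i; apply: agreeZ; apply: mgf.
apply/funext => x; rewrite (_ : _ ^+ k = p.[expR (u x / n.+1%:R)]).
  rewrite horner_coef; apply: eq_bigr => i _; congr (_ * _).
  by rewrite -expRM_natl; congr expR; rewrite -mulrA [_^-1 * _]mulrC.
by rewrite /p horner_exp hornerZ hornerD hornerX hornerN hornerC.
Qed.

Lemma agree_pow k : agree m1 m2 (fun x => u x ^+ k).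
Proof.
apply: (@agree_dominated _ _ _ _ _ (fun n x => exp_quotient n (u x) ^+ k) _
   (fun x => expR ((2 * k%:R) * u x) + expR (- (2 * k%:R) * u x))).
- by move=> n; exact: agree_exp_quotientX.
- by apply: agreeD; exact: mgf.
- by move=> x /=; apply: cvgX; exact: cvg_exp_quotient.
- move=> n x; apply: le_trans (expR_abs_le _ _); last by rewrite mulr_ge0.
  rewrite normrX mulrAC [_ * k%:R]mulrC expRM_natl.
  by apply: lerXn2r; rewrite ?nnegrE ?expR_ge0 // exp_quotient_bound.
Qed.

(** A power series in [u] whose terms are dominated by those of [e^|u|] has partial
    sums bounded by [e^u + e^(-u)], which is integrable; the equality of the
    moments of [u] therefore passes to the sum. *)
Let agree_power_series (c : nat -> R -> R) (f : R -> R) :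
  (forall n, exists b, forall x, c n x = b * x ^+ n) ->
  (forall n x, `|c n x| <= exp_coeff `|x| n) ->
  (forall x, series (c^~ x) @ \oo --> f x) ->
  agree m1 m2 (f \o u).
Proof.
move=> cX cb cf.
apply: (@agree_dominated _ _ _ _ _ (fun n x => series (c^~ (u x)) n) _
   (fun x => expR (1 * u x) + expR (- 1 * u x))).
- move=> n; rewrite (_ : (fun _ => _) = fun x => \sum_(i < n) c i (u x)).
    by apply: agree_sum => i; have [b cE] := cX i; rewrite (_ : (fun _ => _) =
      fun x => b * u x ^+ i); [exact/agreeZ/agree_pow|exact/funext].
  by apply/funext => x; rewrite /series /= big_mkord.
- by apply: agreeD; exact: mgf.
- by move=> x; exact: cf.
- move=> n x; apply: le_trans (expR_abs_le _ _) => //; rewrite mul1r.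
  apply: (@le_trans _ _ (series (exp_coeff `|u x|) n)).
    by rewrite /series /=; apply: le_trans (ler_norm_sum _ _ _) _; exact: ler_sum.
  rewrite /expR; apply: nondecreasing_cvgn_le; last exact: is_cvg_series_exp_coeff.
  apply: (@nondecreasing_series _ _ xpredT) => i _ _; exact: exp_coeff_ge0.
Qed.

Lemma agree_cos : agree m1 m2 (cos \o u).
Proof.
apply: (agree_power_series (c := fun n x => cos_coeff x n)).
- move=> n; exists ((~~ odd n)%:R * (-1) ^+ n./2 / n`!%:R) => x.
  by rewrite /cos_coeff /= mulrAC.
- move=> n x; rewrite /cos_coeff /exp_coeff /= !normrM normrX normrN1 expr1n mulr1 normfV.
  rewrite normr_nat normr_nat normrX ler_wpM2r ?invr_ge0 //.
  by case: (odd n); rewrite /= ?mul0r ?mul1r ?exprn_ge0.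
- by move=> x; rewrite unlock; exact: is_cvg_series_cos_coeff.
Qed.

Lemma agree_sin : agree m1 m2 (sin \o u).
Proof.
apply: (agree_power_series (c := fun n x => sin_coeff x n)).
- move=> n; exists ((odd n)%:R * (-1) ^+ n.-1./2 / n`!%:R) => x.
  by rewrite /sin_coeff /= mulrAC.
- move=> n x; rewrite /sin_coeff /exp_coeff /= !normrM normrX normrN1 expr1n mulr1 normfV.
  rewrite normr_nat normr_nat normrX ler_wpM2r ?invr_ge0 //.
  by case: (odd n); rewrite /= ?mul0r ?mul1r ?exprn_ge0.
- by move=> x; rewrite unlock; exact: is_cvg_series_sin_coeff.
Qed.

End laplace_uniqueness.

(** * Measures separated by trigonometric functions *)
Section threshold.
Context (R : realType).
Implicit Types r t y : R.

Lemma bernoulli_le t n : 0 <= t -> t <= 1 -> 1 - n%:R * t <= (1 - t) ^+ n.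
Proof.
move=> t0 t1; elim: n => [|n IH]; first by rewrite expr0 mul0r subr0.
rewrite exprS; have h : 0 <= 1 - t by lra.
apply: (le_trans _ (ler_wpM2l h IH)).
have : 0 <= n%:R * t * t by rewrite !mulr_ge0.
by rewrite -natr1; nra.
Qed.

Lemma cvg_natr_geometric r : 0 <= r -> r < 1 -> n%:R * r ^+ n @[n --> \oo] --> 0.
Proof.
(* As [r <= s^2] and [n s^n] is bounded by a geometric sum, [n r^n] is at most
   a multiple of [s^n]. *)
move=> r0 r1; pose s := (1 + r) / 2.
have s0 : 0 <= s by rewrite /s; lra.
have s1 : s < 1 by rewrite /s; lra.
have rs : r <= s * s by rewrite /s; have := sqr_ge0 (1 - r); rewrite expr2; nra.
have ns n : n%:R * s ^+ n <= (1 - s)^-1.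
  have h : (1 - s) * (n%:R * s ^+ n) <= 1.
    apply: (@le_trans _ _ ((1 - s) * \sum_(i < n) s ^+ i)).
      apply: ler_wpM2l; first by lra.
      rewrite mulr_natl -[X in _ *+ X]card_ord -sumr_const; apply: ler_sum => i _.
      by apply: ler_wiXn2l; [ |exact: ltW|exact: ltnW].
    rewrite -[1 - s]opprB mulNr -subrX1 opprB.
    by rewrite lerBlDr lerDl exprn_ge0.
  by rewrite -[leRHS]mul1r ler_pdivlMr ?subr_gt0 // mulrC.
apply: (@squeeze_cvgr _ _ _ _ (fun=> 0) (geometric (1 - s)^-1 s)).
- apply: nearW => n; rewrite mulr_ge0 ?exprn_ge0 //=.
  apply: (@le_trans _ _ (n%:R * (s * s) ^+ n)).
    apply: ler_wpM2l => //; apply: lerXn2r => //.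
    by rewrite nnegrE mulr_ge0.
  by rewrite exprMn mulrA; apply: ler_wpM2r; rewrite ?exprn_ge0.
- exact: cvg_cst.
- by apply: cvg_geometric; rewrite ger0_norm.
Qed.

(** Polynomials bounded by [0] and [1] on the unit interval which converge pointwise to
    the indicator of a half-line.  With exponents [k^n] in place of [n 2^n] (as in
    the Brosowski-Deutsch proof of the Stone-Weierstrass theorem) the limit at the
    threshold would be [1/e]; the extra factor [n] makes it [0]. *)
Lemma cvg_threshold y : 0 <= y -> y <= 1 ->
  (1 - y ^+ n) ^+ (n * 2 ^ n) @[n --> \oo] --> (((y < 1 / 2)%R)%:R : R).
Proof.
move=> y0 y1.
have p0 n : 0 <= y ^+ n by exact: exprn_ge0.
have p1 n : y ^+ n <= 1 by exact: exprn_ile1.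
have e n : (n * 2 ^ n)%:R * y ^+ n = n%:R * (2 * y) ^+ n :> R.
  by rewrite natrM natrX exprMn mulrA.
have [yh|yh] := ltP y (1 / 2).
  apply: (@squeeze_cvgr _ _ _ _ (fun n => 1 - n%:R * (2 * y) ^+ n) (fun=> 1)).
  - apply: nearW => n; rewrite -e bernoulli_le //=.
    by apply: exprn_ile1; have := p0 n; have := p1 n; lra.
  - rewrite -[X in _ --> X]subr0; apply: cvgB; first exact: cvg_cst.
    by apply: cvg_natr_geometric; lra.
  - exact: cvg_cst.
apply: (@squeeze_cvgr _ _ _ _ (fun=> 0) (fun n => expR (1 *- n))).
- apply: nearW => n; rewrite exprn_ge0; last by have := p1 n; lra.
  rewrite /= (@le_trans _ _ (expR (- y ^+ n) ^+ (n * 2 ^ n))) //.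
    apply: lerXn2r; rewrite ?nnegrE ?expR_ge0 //; first by have := p1 n; lra.
    exact: expR_ge1Dx.
  rewrite -expRM_natl ler_expR mulrN e lerN2 -[leLHS]mulr1.
  by rewrite ler_wpM2l // exprn_ege1 //; lra.
- exact: cvg_cst.
- exact: cvgn_expR.
Qed.

End threshold.

Section trigonometric_uniqueness.
Context d (S : measurableType d) (R : realType).
Variables m1 m2 : {measure set S -> \bar R}.
Variable V : set (S -> R).
Hypothesis V_measurable : forall u, V u -> measurable_fun setT u.
Hypothesis V0 : V (fun=> 0).
Hypothesis VD : forall u v, V u -> V v -> V (u \+ v).
Hypothesis VZ : forall (a : R) u, V u -> V (fun x => a * u x).
Hypothesis V_cos : forall u, V u -> agree m1 m2 (cos \o u).
Hypothesis V_sin : forall u, V u -> agree m1 m2 (sin \o u).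

Let agree_cosD u (c : R) : V u -> agree m1 m2 (fun x => cos (u x + c)).
Proof.
move=> Vu; rewrite (_ : (fun _ => _) =
  (fun x => cos c * cos (u x)) \+ (fun x => - sin c * sin (u x))).
  by apply: agreeD; apply: agreeZ; [exact: V_cos|exact: V_sin].
by apply/funext => x /=; rewrite cosD; ring.
Qed.

Let agree_cst (K : R) : agree m1 m2 (fun=> K).
Proof.
have := agreeZ K (V_cos V0); rewrite (_ : (fun _ => _) = fun=> K) //.
by apply/funext => x /=; rewrite cos0 mulr1.
Qed.

(** Bounded functions that can be inserted in front of every trigonometric function of
    [V] without breaking the agreement; the phase [c] accounts for sines. *)
Definition trig_agree (f : S -> R) : Prop :=
  [/\ measurable_fun setT f, exists K : R, forall x, `|f x| <= K &
      forall u c, V u -> agree m1 m2 (fun x => f x * cos (u x + c))].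

Let trig_agree_lim (f : nat -> S -> R) (g : S -> R) (K : R) :
  (forall n, trig_agree (f n)) -> (forall n x, `|f n x| <= K) ->
  (forall x, f n x @[n --> \oo] --> g x) -> trig_agree g.
Proof.
move=> Cf fK fg; split.
- have mf n : measurable_fun setT (f n) by case: (Cf n).
  by apply: (measurable_fun_cvg mf) => x _; exact: fg.
- exists K => x; rewrite ler_norml; apply/andP; split.
    rewrite -[g x](cvg_lim _ (fg x)) //; apply: limr_ge; first exact: cvgP (fg x).
    by apply: nearW => n; have := fK n x; rewrite ler_norml => /andP[].
  rewrite -[g x](cvg_lim _ (fg x)) //; apply: limr_le; first exact: cvgP (fg x).
  by apply: nearW => n; have := fK n x; rewrite ler_norml => /andP[].
- move=> u c Vu.
  apply: (@agree_dominated _ _ _ _ _ (fun n x => f n x * cos (u x + c)) _ (fun=> K)).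
  + by move=> n; case: (Cf n) => _ _; exact.
  + exact: agree_cst.
  + by move=> x /=; apply: cvgMr_tmp; exact: fg.
  + move=> n x; rewrite normrM -[leRHS]mulr1; apply: ler_pM => //.
    by rewrite ler_norml cos_geN1 cos_le1.
Qed.

(** The class [trig_agree] is not obviously closed under products, whereas its
    multipliers are by definition. *)
Definition multiplier (g : S -> R) : Prop :=
  forall f, trig_agree f -> trig_agree (fun x => f x * g x).

Let multM g h : multiplier g -> multiplier h -> multiplier (fun x => g x * h x).
Proof.
move=> mg mh f Cf; rewrite (_ : (fun _ => _) = fun x => f x * g x * h x).
  exact/mh/mg.
by apply/funext => x; rewrite mulrA.
Qed.

Let mult_cst (a : R) : multiplier (fun=> a).
Proof.
move=> f [mf [K fK] Cf]; split.
- exact: measurable_funM.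
- exists (K * `|a|) => x; rewrite normrM; exact: ler_wpM2r.
- move=> u c Vu; rewrite (_ : (fun _ => _) = fun x => a * (f x * cos (u x + c))).
    exact/agreeZ/Cf.
  by apply/funext => x; ring.
Qed.

Let multD g h : multiplier g -> multiplier h -> multiplier (fun x => g x + h x).
Proof.
move=> mg mh f Cf.
have [mfg [K fgK] Cfg] := mg f Cf; have [mfh [L fhL] Cfh] := mh f Cf.
rewrite (_ : (fun _ => _) = (fun x => f x * g x) \+ (fun x => f x * h x)); last first.
  by apply/funext => x; rewrite mulrDr.
split.
- exact: measurable_funD.
- by exists (K + L) => x /=; apply: (le_trans (ler_normD _ _)); exact: lerD.
- move=> u c Vu; rewrite (_ : (fun _ => _) = (fun x => f x * g x * cos (u x + c)) \+
      (fun x => f x * h x * cos (u x + c))).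
    by apply: agreeD; [exact: Cfg|exact: Cfh].
  by apply/funext => x /=; rewrite mulrDl.
Qed.

Let mult_onem g : multiplier g -> multiplier (fun x => 1 - g x).
Proof.
move=> mg; have := multD (mult_cst 1) (multM (mult_cst (-1)) mg).
by under eq_fun do rewrite mulN1r.
Qed.

Let multX g n : multiplier g -> multiplier (fun x => g x ^+ n).
Proof.
move=> mg; elim: n => [|n IH].
  by under eq_fun do rewrite expr0; exact: mult_cst.
by under eq_fun do rewrite exprS; exact: multM.
Qed.

Let mult_lim (g_ : nat -> S -> R) (g : S -> R) :
  (forall n, multiplier (g_ n)) -> (forall n x, `|g_ n x| <= 1) ->
  (forall x, g_ n x @[n --> \oo] --> g x) -> multiplier g.
Proof.
move=> mg g1 cg f Cf; have [_ [K fK] _] := Cf.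
apply: (@trig_agree_lim (fun n x => f x * g_ n x) _ K).
- by move=> n; exact: mg.
- by move=> n x; rewrite normrM -[leRHS]mulr1; apply: ler_pM.
- by move=> x; apply: cvgMl_tmp; exact: cg.
Qed.

(** The product of two cosines of elements of [V] is a combination of cosines of
    their sum and difference, which belong to [V]. *)
Let mult_cos v (c : R) : V v -> multiplier (fun x => cos (v x + c)).
Proof.
move=> Vv f [mf [K fK] Cf]; split.
- apply: measurable_funM => //.
  apply: measurableT_comp; last by apply: measurable_funD => //; exact: V_measurable.
  by apply: continuous_measurable_fun; exact: continuous_cos.
- exists K => x; rewrite normrM -[leRHS]mulr1; apply: ler_pM => //.
  by rewrite ler_norml cos_geN1 cos_le1.
- move=> u c' Vu.
  have h1 := agreeZ (1 / 2) (Cf _ (c' + c) (VD Vu Vv)).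
  have h2 := agreeZ (1 / 2) (Cf _ (c' - c) (VD Vu (VZ (-1) Vv))).
  have := agreeD h1 h2; congr agree; apply/funext => x /=.
  have -> : u x + v x + (c' + c) = (u x + c') + (v x + c) by ring.
  have -> : u x + -1 * v x + (c' - c) = (u x + c') - (v x + c) by ring.
  by rewrite cosD cosB; field.
Qed.

Let mult_neg g : multiplier g -> (forall x, `|g x| <= 1) ->
  multiplier (fun x => ((g x < 0)%R)%:R).
Proof.
(* An affine change of variable moves the threshold from [0] to [1/2]. *)
move=> mg g1; pose y x := 1 / 2 + 1 / 2 * g x.
have y0 x : 0 <= y x.
  by have := g1 x; rewrite ler_norml /y => /andP[]; lra.
have y1 x : y x <= 1.
  by have := g1 x; rewrite ler_norml /y => /andP[]; lra.
have my : multiplier y by apply: multD => //; exact: multM.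
apply: (@mult_lim (fun n x => (1 - y x ^+ n) ^+ (n * 2 ^ n))).
- by move=> n; apply: multX; apply: mult_onem; exact: multX.
- move=> n x; have p0 : 0 <= y x ^+ n by exact: exprn_ge0.
  have p1 : y x ^+ n <= 1 by exact: exprn_ile1.
  rewrite ger0_norm; first by apply: exprn_ile1; lra.
  by apply: exprn_ge0; lra.
- move=> x; have := cvg_threshold (y0 x) (y1 x).
  rewrite (_ : (y x < 1 / 2)%R = (g x < 0)%R) //.
  by rewrite /y; apply/idP/idP; lra.
Qed.

(** The sign of [v x - c] is that of [sin ((v x - c) / n)] once [n] is large, and
    this sine is a multiplier, being a cosine of [v / n] up to a phase. *)
Let mult_lt v (c : R) : V v -> multiplier (fun x => ((v x < c)%R)%:R).
Proof.
move=> Vv; pose z n x := (v x - c) / n.+1%:R.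
apply: (@mult_lim (fun n x => ((sin (z n x) < 0)%R)%:R)).
- move=> n; apply: mult_neg => [|x]; last by rewrite ler_norml sin_geN1 sin_le1.
  have := mult_cos (- c / n.+1%:R - pi / 2) (VZ n.+1%:R^-1 Vv).
  congr multiplier; apply/funext => x; rewrite -cosBpihalf; congr cos.
  by rewrite /z; ring.
- by move=> n x; rewrite ger0_norm //; case: (_ < _)%R.
- move=> x; apply: cvg_near_cst.
  have [m vm] : exists m : nat, `|v x - c| < m%:R.
    by exists (Num.bound `|v x - c|); exact: archi_boundP.
  near=> n.
  have nm : (m <= n)%N by near: n; exact: nbhs_infty_ge.
  have n0 : 0 < n.+1%:R :> R by [].
  have zpi : `|z n x| < pi.
    rewrite /z normrM normfV normr_nat ltr_pdivrMr //.
    apply: (lt_le_trans vm); apply: (@le_trans _ _ n.+1%:R).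
      by rewrite ler_nat (leq_trans nm).
    by rewrite ler_peMl //; have := pi_ge2 R; lra.
  congr (_%:R); congr nat_of_bool.
  have [vc|vc] := ltP (v x) c.
    have z0 : z n x < 0 by rewrite /z pmulr_llt0 ?invr_gt0 // subr_lt0.
    rewrite -[z n x]opprK sinN oppr_lt0 sin_gt0_pi //.
    by rewrite oppr_gt0 z0 /= -ltr0_norm.
  have z0 : 0 <= z n x by rewrite /z divr_ge0 // subr_ge0.
  apply/negbTE; rewrite -leNgt; apply: sin_ge0_pi.
  by rewrite z0 /= ltW // -(ger0_norm z0).
Unshelve. all: by end_near. Qed.

Definition multiplier_set (E : set S) : Prop := multiplier (\1_E : S -> R).

(** A product of multipliers is a multiplier, so this class is closed under finite
    intersections: it is a sigma-algebra and not merely a Dynkin system. *)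
Lemma sigma_algebra_multiplier_set : sigma_algebra setT multiplier_set.
Proof.
split.
- by rewrite /multiplier_set indic0; exact: mult_cst.
- move=> A /mult_onem; rewrite /multiplier_set setTD; congr multiplier.
  apply/funext => x; rewrite !indicE in_setC.
  by case: (x \in A); rewrite /= ?subrr ?subr0.
- move=> A mA; rewrite /multiplier_set.
  rewrite (_ : \1_ _ = fun x => 1 - \1_(~` \bigcup_k A k) x); last first.
    apply/funext => x; rewrite !indicE in_setC.
    by case: (x \in _); rewrite /= ?subrr ?subr0.
  apply: mult_onem.
  apply: (@mult_lim (fun n x => \prod_(i < n) (1 - \1_(A i) x))).
  + elim=> [|n IH].
      by under eq_fun do rewrite big_ord0; exact: mult_cst.
    by under eq_fun do rewrite big_ord_recr; apply: multM => //; exact/mult_onem/mA.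
  + move=> n x; rewrite ger0_norm.
      apply: prodr_ile1 => i; rewrite indicE.
      by case: (_ \in _); rewrite /= ?subrr ?subr0 lexx ler01.
    apply: prodr_ge0 => i _; rewrite indicE.
    by case: (_ \in _); rewrite /= ?subrr ?subr0.
  + move=> x; apply: cvg_near_cst; rewrite indicE in_setC.
    have [[k _ Akx]|nA] := pselect ((\bigcup_k A k) x).
      near=> n; have kn : (k < n)%N by near: n; exact: nbhs_infty_gt.
      rewrite mem_set /=; last by exists k.
      rewrite (bigD1 (Ordinal kn)) //= indicE mem_set //= subrr mul0r //.
    apply: nearW => n; rewrite memNset //= big1 // => i _.
    rewrite indicE memNset ?subr0 // => Ax; apply: nA; by exists i.
Unshelve. all: by end_near. Qed.

Let multiplier_preimage v B : V v -> measurable B -> multiplier_set (v @^-1` B).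
Proof.
move=> Vv mB.
have : <<s @RGenInftyO.G R >> B.
  by have : (@RGenInftyO.G R).-sigma.-measurable B by rewrite -RGenInftyO.measurableE.
move: B {mB}; apply: (@smallest_sub _ _ _ [set B | multiplier_set (v @^-1` B)]).
  have [h0 hC hU] := sigma_algebra_multiplier_set; split => /=.
  - by rewrite preimage_set0.
  - by move=> A /hC; rewrite !setTD preimage_setC.
  - by move=> A hA; rewrite preimage_bigcup; exact: hU.
move=> _ [c ->] /=; rewrite /multiplier_set.
have := mult_lt c Vv; congr multiplier; apply/funext => x.
by rewrite indicE; congr (_%:R); congr nat_of_bool; apply/idP/idP;
   rewrite in_setE /= in_itv.
Qed.

(** Every event of the sigma-algebra generated by [V] is a multiplier set; applying
    its indicator to the constant [1], with phase [0] and [u = 0], compares its two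
    measures. *)
Theorem trigonometric_uniqueness E :
  <<s \bigcup_(v in V) preimage_set_system setT v measurable >> E ->
  m1 E = m2 E.
Proof.
move=> sE.
have mE : measurable E.
  move: E sE; apply: smallest_sub; first exact: sigma_algebra_measurable.
  by move=> _ [v Vv [B mB <-]]; exact: V_measurable.
have : multiplier_set E.
  move: E sE {mE}; apply: smallest_sub; first exact: sigma_algebra_multiplier_set.
  by move=> _ [v Vv [B mB <-]]; rewrite setTI; exact: multiplier_preimage.
move=> /(_ (fun=> 1)) [|_ _ /(_ _ 0 V0) [_ _]].
  split; [exact: measurable_cst|by exists 1 => x; rewrite normr1|].
  by move=> u c Vu; under eq_fun do rewrite mul1r; exact: agree_cosD.
under eq_integral do rewrite mul1r addr0 cos0 mulr1.
under [RHS]eq_integral do rewrite mul1r addr0 cos0 mulr1.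
by rewrite !integral_indic // !setIT.
Qed.

End trigonometric_uniqueness.

(** * Mixtures of measures and laws under a density *)
Section mixture.
Context d d' (X : measurableType d) (Y : measurableType d') (R : realType).
Variables (m : {measure set X -> \bar R}) (k : R.-ker X ~> Y).
Local Open Scope ereal_scope.

Definition mixture (U : set Y) : \bar R := \int[m]_x k x U.

Let mixture0 : mixture set0 = 0.
Proof. by rewrite /mixture integral0_eq. Qed.

Let mixture_ge0 U : 0 <= mixture U.
Proof. exact: integral_ge0. Qed.

Let mixture_semi_sigma_additive : semi_sigma_additive mixture.
Proof.
move=> U mU tU mUU; rewrite [X in _ --> X](_ : _ =
  \int[m]_x (\sum_(n <oo) k x (U n))); last first.
  apply: eq_integral => x _.
  by apply/esym/cvg_lim => //; exact/measure_semi_sigma_additive.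
rewrite integral_nneseries //; last by move=> n; exact: measurable_kernel.
by apply: is_cvg_nneseries => n _ _; exact: integral_ge0.
Qed.

HB.instance Definition _ := isMeasure.Build _ _ _
  mixture mixture0 mixture_ge0 mixture_semi_sigma_additive.

Import HBNNSimple.

Let integral_mixture_nnsfun (f : {nnsfun Y >-> R}) :
  \int[mixture]_y (f y)%:E = \int[m]_x \int[k x]_y (f y)%:E.
Proof.
rewrite integralT_nnsfun sintegralE.
under [RHS]eq_integral do rewrite integralT_nnsfun sintegralE.
rewrite ge0_integral_fsum //.
- apply: eq_fsbigr => r /set_mem [y _ <-].
  rewrite ge0_integralZl // ?lee_fin //.
  exact: measurable_kernel.
- move=> r; apply: measurable_funeM; exact: measurable_kernel.
- by move=> r x _; exact: nnsfun_mulemu_ge0.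
Qed.

Lemma integral_mixture (f : Y -> \bar R) : (forall y, 0 <= f y) ->
  measurable_fun setT f ->
  \int[mixture]_y f y = \int[m]_x \int[k x]_y f y.
Proof.
move=> f0 mf; pose f_ := nnsfun_approx measurableT mf.
have f_f y : limn (fun n => (f_ n y)%:E) = f y.
  by apply/cvg_lim => //; exact: cvg_nnsfun_approx.
have f_0 n y : setT y -> 0 <= (f_ n y)%:E by rewrite lee_fin.
have mf_ n : measurable_fun setT (fun y => (f_ n y)%:E) by exact/measurable_EFinP.
have nd y : setT y -> {homo (fun n => (f_ n y)%:E) : p q / (p <= q)%N >-> p <= q}.
  by move=> _ p q pq; rewrite lee_fin; exact/lefP/nd_nnsfun_approx.
have cv (nu : {measure set Y -> \bar R}) :
    \int[nu]_y (f_ n y)%:E @[n --> \oo] --> \int[nu]_y f y.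
  rewrite (eq_integral (fun y => limn (fun n => (f_ n y)%:E))) //.
  exact: cvg_monotone_convergence.
apply: (cvg_unique _ (cv _)) => //=.
rewrite (_ : (fun n => _) = fun n => \int[m]_x \int[k x]_y (f_ n y)%:E); last first.
  by apply/funext => n; exact: integral_mixture_nnsfun.
rewrite (eq_integral (fun x => limn (fun n => \int[k x]_y (f_ n y)%:E))); last first.
  by move=> x _; apply/esym/cvg_lim => //; exact: cv.
apply: cvg_monotone_convergence => //.
- move=> n; apply: measurable_fun_integral_kernel => //; first exact: measurable_kernel.
  by move=> y; exact: f_0.
- by move=> n x _; apply: integral_ge0 => y _; exact: f_0.
- move=> x _ p q pq; apply: ge0_le_integral => // y _; [exact: f_0|exact: (nd y I _ _ pq)].
Qed.

End mixture.

Section weighted_dirac.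
Context d d' (X : measurableType d) (Y : measurableType d') (R : realType).
Variables (w : X -> R) (phi : X -> Y).
Hypothesis w0 : forall x, 0 <= w x.
Hypothesis mw : measurable_fun setT w.
Hypothesis mphi : measurable_fun setT phi.

(** The two measurability proofs are arguments only so that the kernel structure can be
    inferred from the term. *)
Definition weighted_dirac (_ : measurable_fun setT w) (_ : measurable_fun setT phi)
  (x : X) : {measure set Y -> \bar R} := mscale (NngNum (w0 x)) (\d_(phi x)).

Let measurable_weighted_dirac U : measurable U ->
  measurable_fun setT (weighted_dirac mw mphi ^~ U).
Proof.
move=> mU; apply/measurable_EFinP; apply: measurable_funM => //.
by rewrite (_ : (fun x => _) = mindic R mU \o phi) //; exact/measurableT_comp.
Qed.

HB.instance Definition _ := isKernel.Build _ _ _ _ _ (weighted_dirac mw mphi)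
  measurable_weighted_dirac.

End weighted_dirac.

Section weighted_law.
Context d d' (X : measurableType d) (Y : measurableType d') (R : realType).
Variables (m : {measure set X -> \bar R}) (w : X -> R) (phi : X -> Y).
Hypothesis w0 : forall x, 0 <= w x.
Hypothesis mw : measurable_fun setT w.
Hypothesis mphi : measurable_fun setT phi.

(** The image under [phi] of the measure with density [w] with respect to [m].
    Describing it as a mixture of point masses yields image measures and densities
    from the single formula [integral_mixture]. *)
Definition weighted_law : {measure set Y -> \bar R} :=
  mixture m (weighted_dirac w0 mw mphi).

Lemma ge0_integral_weighted_law (f : Y -> \bar R) : (forall y, 0 <= f y)%E ->
  measurable_fun setT f ->
  (\int[weighted_law]_y f y = \int[m]_x ((w x)%:E * f (phi x)))%E.
Proof.
move=> f0 mf; rewrite integral_mixture //; apply: eq_integral => x _.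
rewrite /weighted_dirac ge0_integral_mscale //= integral_dirac //.
by rewrite diracT mul1e.
Qed.

Lemma weighted_lawE U : measurable U ->
  weighted_law U = (\int[m]_x ((w x)%:E * (\1_U (phi x))%:E))%E.
Proof.
move=> mU; transitivity (\int[weighted_law]_y (\1_U y)%:E)%E.
  by rewrite integral_indic // setIT.
rewrite ge0_integral_weighted_law //.
exact/measurable_EFinP/measurable_indic.
Qed.

Lemma integrable_weighted_law (f : Y -> R) : measurable_fun setT f ->
  weighted_law.-integrable setT (EFin \o f) <->
  m.-integrable setT (fun x => (w x * f (phi x))%:E).
Proof.
move=> mf.
have mwf : measurable_fun setT (fun x => (w x * f (phi x))%:E).
  by apply/measurable_EFinP; apply: measurable_funM => //; exact: measurableT_comp.
have e : (\int[weighted_law]_y `|(f y)%:E| = \int[m]_x `|(w x * f (phi x))%:E|)%E.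
  rewrite ge0_integral_weighted_law //.
    by apply: eq_integral => x _; rewrite -EFinM /= normrM ger0_norm.
  by apply: measurableT_comp => //; exact/measurable_EFinP.
split=> /integrableP[_ i]; apply/integrableP; split => //.
- by rewrite -e.
- exact/measurable_EFinP.
- by rewrite /= e.
Qed.

Lemma integral_weighted_law (f : Y -> R) : measurable_fun setT f ->
  (\int[weighted_law]_y (f y)%:E = \int[m]_x (w x * f (phi x))%:E)%E.
Proof.
move=> mf; rewrite [LHS]integralE [RHS]integralE.
have mEf : measurable_fun setT (EFin \o f) by exact/measurable_EFinP.
rewrite !ge0_integral_weighted_law //; last 2 first.
- exact: measurable_funeneg.
- exact: measurable_funepos.
congr (_ - _)%E; apply: eq_integral => x _.
- by rewrite !funeposE /= -!EFin_max -EFinM maxr_pMr // mulr0.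
- by rewrite !funenegE /= -!EFin_max -EFinM maxr_pMr // mulr0 mulrN.
Qed.

End weighted_law.

(** * Exponential moments of Gaussian variables *)
Section gaussian.
Context d (Omega : measurableType d) (R : realType).
Variables (P : probability Omega R).
Implicit Types Y : {mfun Omega >-> R}.

(** Completing the square: an exponential tilt of a centered Gaussian density is a
    shifted Gaussian density. *)
Lemma expRM_normal_pdf (s a x : R) : s != 0 ->
  expR (a * x) * normal_pdf 0 s x =
  expR (a ^+ 2 * s ^+ 2 / 2) * normal_pdf (a * s ^+ 2) s x.
Proof.
move=> s0; rewrite !normal_pdfE // /normal_fun mulrCA [RHS]mulrCA -!expRD.
by congr (_ * expR _); field.
Qed.

(** Stated for a measure on [R] that has the same values as the normal law, since the
    latter lives on a copy of the real line with another measurable structure. *)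
Lemma integral_expRM_normal_prob (m : {measure set R -> \bar R}) (s a : R) :
  s != 0 -> (forall A, measurable A -> m A = normal_prob 0 s A) ->
  (\int[m]_x (expR (a * x))%:E = (expR (a ^+ 2 * s ^+ 2 / 2))%:E)%E.
Proof.
move=> s0 ms.
have me : measurable_fun setT (fun x : R => expR (a * x)).
  by apply: measurableT_comp => //; exact: measurable_funM.
have mid : measurable_fun setT (idfun : measurableTypeR R -> R).
  by move=> _ A mA; rewrite setTI.
rewrite (eq_measure_integral (weighted_law lebesgue_measure (normal_pdf_ge0 0 s)
  (measurable_normal_pdf 0 s) mid)); last first.
  move=> A mA _; rewrite weighted_lawE // ms //.
  transitivity (\int[lebesgue_measure]_(x in A) (normal_pdf 0 s x)%:E)%E; first by [].
  rewrite [LHS]integral_mkcond.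
  apply: eq_integral => x _; rewrite patchE indicE.
  by case: ifP => xA; rewrite /= ?mule1 ?mule0.
rewrite ge0_integral_weighted_law; last 2 first.
- by move=> y; rewrite lee_fin expR_ge0.
- exact/measurable_EFinP.
under eq_integral do rewrite -EFinM mulrC expRM_normal_pdf // EFinM.
rewrite integralZl //; last exact: integrable_normal_pdf.
by rewrite integral_normal_pdf mule1.
Qed.

Lemma gaussian_mgf Y : centered_gaussian P Y -> exists v : R, forall a : R,
  (\int[P]_w (expR (a * Y w))%:E = (expR (a ^+ 2 * v / 2))%:E)%E.
Proof.
move=> [s PY]; exists (s ^+ 2) => a.
have me : measurable_fun setT (fun x : R => (expR (a * x))%:E).
  by apply/measurable_EFinP; apply: measurableT_comp => //; exact: measurable_funM.
have -> : (\int[P]_w (expR (a * Y w))%:E =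
    \int[distribution P Y]_x (expR (a * x))%:E)%E.
  by rewrite ge0_integral_distribution // => y; rewrite lee_fin expR_ge0.
have [s0|s0] := eqVneq s 0.
  rewrite (eq_measure_integral (\d_(0 : R))).
    by rewrite integral_dirac // diracT mul1e s0 mulr0 expr0n mulr0 mul0r.
  by move=> A mA _; have := PY A mA; rewrite s0 eqxx.
apply: integral_expRM_normal_prob => // A mA.
by have := PY A mA; rewrite (negbTE s0).
Qed.

(** The variance parameter is identified with the second moment by evaluating the
    exponential moments of the squared difference quotients of [a |-> e^(a Y)] at
    [0], which converge to [Y^2]. *)
Lemma gaussian_exp Y : centered_gaussian P Y ->
  (\int[P]_w (expR (Y w))%:E = (expR (2^-1 * \int[P]_w (Y w ^+ 2)))%:E)%E.
Proof.
move=> /gaussian_mgf [v mgf].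
have mE (a : R) : measurable_fun setT (fun w => (expR (a * Y w))%:E).
  by apply/measurable_EFinP; apply: measurableT_comp => //; exact: measurable_funM.
have iE (a : R) : P.-integrable setT (fun w => (expR (a * Y w))%:E).
  apply/integrableP; split => //.
  under eq_integral do rewrite gee0_abs ?lee_fin ?expR_ge0 //.
  by rewrite mgf ltry.
pose q n w := exp_quotient n (Y w) ^+ 2.
have qE n w : q n w = n.+1%:R ^+ 2 * expR (2 / n.+1%:R * Y w) +
    (- 2 * n.+1%:R ^+ 2 * expR (n.+1%:R^-1 * Y w) + n.+1%:R ^+ 2).
  rewrite /q /exp_quotient -mulrA expRM_natl [Y w / _]mulrC; ring.
(* With step [1 / (n + 1)^2], which is [exp_quotient] at index [k n], the mean of [q n] is
   a difference of two difference quotients of the exponential function. *)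
pose k n := (n.+1 ^ 2).-1.
have kE n : (k n).+1%:R = n.+1%:R ^+ 2 :> R by rewrite prednK ?expn_gt0 // natrX.
have iq n : (\int[P]_w (q n w)%:E = (exp_quotient (k n) (2 * v) -
    2 * exp_quotient (k n) (v / 2))%:E)%E.
  have i1 := integrableZl measurableT (n.+1%:R ^+ 2) (iE (2 / n.+1%:R)).
  have i2 := integrableZl measurableT (- 2 * n.+1%:R ^+ 2) (iE (n.+1%:R^-1)).
  have i3 : P.-integrable setT (fun=> (n.+1%:R ^+ 2)%:E).
    exact: finite_measure_integrable_cst.
  under eq_integral do rewrite qE EFinD EFinM [X in (_ + X)%E]EFinD [X in (_ + (X + _))%E]EFinM.
  rewrite integralD //=; last exact: integrableD.
  rewrite integralD //= !integralZl //= integral_cst //= probability_setT mule1.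
  rewrite !mgf -!EFinM -!EFinD /exp_quotient kE.
  congr EFin; have n0 : n.+1%:R != 0 :> R by [].
  rewrite (_ : (2 / n.+1%:R) ^+ 2 * v / 2 = 2 * v / n.+1%:R ^+ 2); last by field.
  rewrite (_ : (n.+1%:R^-1) ^+ 2 * v / 2 = v / 2 / n.+1%:R ^+ 2); last by field.
  by ring.
have k_oo : k n @[n --> \oo] --> \oo.
  apply/cvgnyPge => A; near=> n.
  rewrite -ltnS prednK ?expn_gt0 // (@leq_trans n.+1) //.
    by rewrite ltnS; near: n; exact: nbhs_infty_ge.
  by rewrite -mulnn leq_pmulr.
have ck (x : R) : exp_quotient (k n) x @[n --> \oo] --> x.
  apply: (cvg_comp k (fun n => exp_quotient n x) k_oo); exact: cvg_exp_quotient.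
have lq : (\int[P]_w (q n w)%:E)%E @[n --> \oo] --> v%:E.
  under eq_fun do rewrite iq.
  have vE : 2 * v - 2 * (v / 2) = v by field.
  suff : exp_quotient (k n) (2 * v) - 2 * exp_quotient (k n) (v / 2)
      @[n --> \oo] --> 2 * v - 2 * (v / 2).
    by rewrite vE => h; apply: cvg_EFin; first exact: nearW.
  by apply: cvgB; [exact: ck|apply: cvgMl_tmp; exact: ck].
have mY2 : measurable_fun setT (fun w => (Y w ^+ 2)%:E).
  by apply/measurable_EFinP; exact: measurable_funX.
have [_ _ lY] : [/\ P.-integrable setT (fun w => (Y w ^+ 2)%:E),
    [sequence (\int[P]_w `|(q n w)%:E - (Y w ^+ 2)%:E|)%E]_n @ \oo --> 0%E &
    [sequence (\int[P]_w (q n w)%:E)%E]_n @ \oo --> (\int[P]_w (Y w ^+ 2)%:E)%E].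
  apply: (@dominated_convergence _ _ _ P setT measurableT _ _
     (fun w => (expR (4 * Y w))%:E + (expR (- 4 * Y w))%:E)%E) => //.
  - move=> n; under eq_fun do rewrite qE; apply/measurable_EFinP.
    by apply: measurable_funD; [|apply: measurable_funD => //];
      apply: measurable_funM => //; exact/measurable_EFinP/mE.
  - apply: aeW => w _; apply: cvg_EFin; first exact: nearW.
    exact/cvgX/cvg_exp_quotient.
  - exact: integrableD.
  - apply: aeW => w n _; rewrite lee_fin /q normrX.
    apply: (@le_trans _ _ (expR (4 * `|Y w|))).
      rewrite (_ : 4 * _ = 2%:R * (2 * `|Y w|)); last by ring.
      rewrite expRM_natl; apply: lerXn2r; rewrite ?nnegrE ?expR_ge0 //.
      exact: exp_quotient_bound.
    have [y0|y0] := leP 0 (Y w); first by rewrite ger0_norm // lerDl expR_ge0.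
    by rewrite ltr0_norm // mulrN mulNr lerDr expR_ge0.
have vE := cvg_unique _ lY lq.
have -> : (\int[P]_w (expR (Y w))%:E = \int[P]_w (expR (1 * Y w))%:E)%E.
  by apply: eq_integral => w _; rewrite mul1r.
by rewrite mgf /Rintegral vE //= expr1n mul1r mulrC.
Unshelve. all: by end_near. Qed.

End gaussian.

(** * Square-integrable functions: inner product, completeness, Riesz theorem *)
Section L2_inner.
Context d (T : measurableType d) (R : realType).
Variable mu : {measure set T -> \bar R}.
Implicit Types f g h : L2 mu.

Lemma L2_integrableM f g : mu.-integrable setT (fun x => (f x * g x)%:E).
Proof. by apply/Lfun1_integrable; apply: Lfun2_mul_Lfun1; exact: LfunP. Qed.

Lemma integral_L2inner f g : (\int[mu]_x (f x * g x)%:E)%E = (L2inner f g)%:E.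
Proof. by rewrite /L2inner /Rintegral fineK // integrable_fin_num //; exact: L2_integrableM. Qed.

Lemma L2innerC f g : L2inner f g = L2inner g f.
Proof. by apply: eq_Rintegral => x _; rewrite mulrC. Qed.

Lemma L2innerDl f g h : L2inner (f + g) h = L2inner f h + L2inner g h.
Proof.
rewrite /L2inner -RintegralD //; [|exact: L2_integrableM|exact: L2_integrableM].
by apply: eq_Rintegral => x _; rewrite -mulrDl.
Qed.

Lemma L2innerZl (a : R) f h : L2inner (a *: f) h = a * L2inner f h.
Proof.
rewrite /L2inner -RintegralZl //; last exact: L2_integrableM.
by apply: eq_Rintegral => x _; rewrite mulrA.
Qed.

Lemma L2innerDr f g h : L2inner h (f + g) = L2inner h f + L2inner h g.
Proof. by rewrite !(L2innerC h) L2innerDl. Qed.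

Lemma L2innerZr (a : R) f h : L2inner h (a *: f) = a * L2inner h f.
Proof. by rewrite !(L2innerC h) L2innerZl. Qed.

Lemma L2innerNl f h : L2inner (- f) h = - L2inner f h.
Proof. by rewrite -scaleN1r L2innerZl mulN1r. Qed.

Lemma L2innerBl f g h : L2inner (f - g) h = L2inner f h - L2inner g h.
Proof. by rewrite L2innerDl L2innerNl. Qed.

Lemma L2innerBr f g h : L2inner h (f - g) = L2inner h f - L2inner h g.
Proof. by rewrite !(L2innerC h) L2innerBl. Qed.

Lemma L2inner_ge0 f : 0 <= L2inner f f.
Proof. by apply: Rintegral_ge0 => x _; rewrite -expr2 sqr_ge0. Qed.

(** Expand the nonnegative square norm of [t f - s g] with [s = 1] and [s = -1]. *)
Lemma L2inner_young (t : R) f g : 0 < t ->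
  2 * `|L2inner f g| <= t * L2inner f f + t^-1 * L2inner g g.
Proof.
move=> t0; have s0 : t != 0 by rewrite gt_eqF.
have p (s : R) : s ^+ 2 = 1 ->
    2 * (s * L2inner f g) <= t * L2inner f f + t^-1 * L2inner g g.
  move=> s2; have := L2inner_ge0 (t *: f - s *: g).
  rewrite L2innerBl !L2innerBr !L2innerZl !L2innerZr (L2innerC g f).
  move=> h; rewrite -subr_ge0.
  have {h} := mulr_ge0 (ltW (ltr0n R 1)) h; rewrite mul1r => h.
  rewrite -(pmulr_rge0 _ t0).
  apply: (le_trans h); rewrite le_eqVlt; apply/orP; left; apply/eqP.
  rewrite (_ : s * (s * L2inner g g) = s ^+ 2 * L2inner g g); last by ring.
  by rewrite s2; field.
have [b0|b0] := leP 0 (L2inner f g).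
  by rewrite ger0_norm //; have := p 1; rewrite expr1n mul1r; exact.
by rewrite ltr0_norm // -mulN1r; apply: p; rewrite sqrrN expr1n.
Qed.

Lemma L2inner_cauchy_schwarz f g :
  L2inner f g ^+ 2 <= L2inner f f * L2inner g g.
Proof.
set b := L2inner f g; set p := L2inner f f; set q := L2inner g g.
have p0 : 0 <= p by exact: L2inner_ge0.
have q0 : 0 <= q by exact: L2inner_ge0.
have Y (t : R) : 0 < t -> 2 * `|b| <= t * p + t^-1 * q by exact: L2inner_young.
rewrite -real_normK ?num_real //.
have [->|b0] := eqVneq b 0; first by rewrite normr0 expr0n mulr_ge0.
have nb : 0 < `|b| by rewrite normr_gt0.
have nb0 : `|b| != 0 by rewrite gt_eqF.
have [pE|pn0] := eqVneq p 0.
  (* If [p = 0], the inequality for a large [t] contradicts [b != 0]. *)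
  have q1 : 0 < q + 1 by lra.
  have := Y ((q + 1) / `|b|) (divr_gt0 q1 nb).
  rewrite pE mulr0 add0r invf_div.
  have : `|b| / (q + 1) * q <= `|b|.
    have qq : (q + 1)^-1 * q <= 1 by rewrite mulrC ler_pdivrMr //; lra.
    by rewrite -mulrA ler_piMr.
  lra.
have pp : 0 < p by rewrite lt_neqAle eq_sym pn0.
have := Y (`|b| / p) (divr_gt0 nb pp).
rewrite invf_div divfK // => h.
have : `|b| <= p / `|b| * q by lra.
by rewrite mulrAC ler_pdivlMr.
Qed.

Lemma L2inner_aer f g h : g = h %[ae mu] -> L2inner f g = L2inner f h.
Proof.
move=> gh; apply: EFin_inj; rewrite -!integral_L2inner.
apply: ae_eq_integral => //.
- by case/integrableP: (L2_integrableM f g).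
- by case/integrableP: (L2_integrableM f h).
- by apply: filterS gh => x + _ => /(_ I) ->.
Qed.

Lemma L2inner_aerl f g h : g = h %[ae mu] -> L2inner g f = L2inner h f.
Proof. by rewrite !(L2innerC _ f); exact: L2inner_aer. Qed.

Lemma L2norm_sqr f : (L2norm f * L2norm f = (L2inner f f)%:E)%E.
Proof.
have fin : L2norm f \is a fin_num.
  by rewrite ge0_fin_numE ?Lnorm_ge0 //; exact: Lfunction_finite.
have := @powR_Lnorm _ _ _ mu (EFin \o f) 2 (negbT (pnatr_eq0 R 2)).
rewrite -/(L2norm f) -integral_L2inner -(fineK fin) poweR_EFin powR_mulrn ?fine_ge0 ?Lnorm_ge0 //.
rewrite -EFinM -expr2 => ->; apply: eq_integral => x _ /=.
by rewrite powR_mulrn // -normrX ger0_norm // sqr_ge0.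
Qed.

Lemma L2_of_sqr (h : T -> R) (c : R) : measurable_fun setT h ->
  (\int[mu]_x (h x ^+ 2)%:E <= c%:E)%E ->
  exists2 H : L2 mu, H =1 h & L2inner H H <= c.
Proof.
move=> mh hc.
have hL : h \in Lfun mu 2%:E.
  apply/andP; split; rewrite inE //= /finite_norm unlock /Lnorm poweR_lty //.
  rewrite (le_lt_trans _ (ltry c)) //; apply: le_trans hc.
  rewrite le_eqVlt; apply/orP; left; apply/eqP; apply: eq_integral => x _ /=.
  by rewrite powR_mulrn // -normrX ger0_norm // sqr_ge0.
exists (Lfun_Sub (lee1n 2) hL) => //.
by rewrite -lee_fin -integral_L2inner.
Qed.

End L2_inner.

Section L2_complete.
Context d (T : measurableType d) (R : realType).
Variable mu : {finite_measure set T -> \bar R}.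

(** The sum of the increments has finite integral, hence is finite almost everywhere,
    and an absolutely convergent series converges. *)
Lemma ae_cvgn_of_sum (f : nat -> T -> R) :
  (forall n, measurable_fun setT (f n)) ->
  (\sum_(n <oo) \int[mu]_x `|(f n.+1 x - f n x)%:E| < +oo)%E ->
  {ae mu, forall x, cvgn (f ^~ x)}.
Proof.
move=> mf sf.
have mh n : measurable_fun setT (fun x => `|(f n.+1 x - f n x)%:E|%E).
  by apply: measurableT_comp => //; apply/measurable_EFinP; exact: measurable_funB.
have iS : mu.-integrable setT (fun x => \sum_(n <oo) `|(f n.+1 x - f n x)%:E|)%E.
  apply/integrableP; split.
    exact: (@ge0_emeasurable_sum _ _ _ setT (fun n x => `|(f n.+1 x - f n x)%:E|%E) xpredT).
  rewrite (eq_integral (fun x => \sum_(n <oo) `|(f n.+1 x - f n x)%:E|))%E.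
    by rewrite integral_nneseries.
  by move=> x _; rewrite gee0_abs // nneseries_ge0.
apply: filterS (integrable_ae measurableT iS) => x /(_ I) fx.
pose u := telescope (f ^~ x).
suff : cvgn (series u).
  rewrite telescopeK => cu.
  rewrite (_ : f ^~ x = (fun n => f n x - f 0%N x) \+ cst (f 0%N x)).
    by apply: is_cvgD => //; exact: is_cvg_cst.
  by apply/funext => n /=; rewrite subrK.
apply: normed_cvg; apply: nondecreasing_is_cvgn.
  by apply: (@nondecreasing_series _ _ xpredT) => n _ _; exact: normr_ge0.
exists (fine (\sum_(n <oo) `|(f n.+1 x - f n x)%:E|))%E => _ [n _ <-].
rewrite -lee_fin fineK //.
rewrite (_ : (_ n)%:E = (\sum_(0 <= k < n) `|(f k.+1 x - f k x)%:E|)%E).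
  exact: nneseries_lim_ge.
by rewrite /series /= -sumEFin.
Qed.

(** Completeness, for sequences whose Cauchy rate is geometric.  The increments are
    then summable in [L^1], because the measure is finite, so the sequence converges
    almost everywhere; Fatou's lemma transfers the rate to the limit. *)
Lemma L2_fast_complete (f : nat -> L2 mu) (c : R) :
  (forall n m, (n <= m)%N -> L2inner (f m - f n) (f m - f n) <= c * 4^-1 ^+ n) ->
  exists F : L2 mu, forall n, L2inner (F - f n) (F - f n) <= c * 4^-1 ^+ n.
Proof.
move=> fc.
have c0 : 0 <= c.
  by have := fc 0%N 0%N isT; rewrite expr0 mulr1; apply: le_trans; exact: L2inner_ge0.
have mf n : measurable_fun setT (f n) by [].
pose K := (fine (mu setT) + c) / 2.
have K0 : 0 <= K by rewrite divr_ge0 // addr_ge0 // fine_ge0.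
(* Since [|y| <= (2^-n + 2^n y^2) / 2], the increments have [L^1] norms of order [2^-n]. *)
have step n : (\int[mu]_x `|(f n.+1 x - f n x)%:E| <= (K / 2 ^+ n)%:E)%E.
  pose t : R := 2 ^+ n.
  have t0 : 0 < t by exact: exprn_gt0.
  have tn0 : t != 0 by rewrite gt_eqF.
  have i1 : mu.-integrable setT (fun=> (t^-1 / 2)%:E).
    exact: finite_measure_integrable_cst.
  have i2 := integrableZl measurableT (t / 2) (L2_integrableM (f n.+1 - f n) (f n.+1 - f n)).
  apply: (@le_trans _ _ (\int[mu]_x ((t^-1 / 2)%:E +
     (t / 2)%:E * ((f n.+1 - f n) x * (f n.+1 - f n) x)%:E))%E).
    apply: ge0_le_integral => //.
    - by apply: measurableT_comp => //; apply/measurable_EFinP; exact: measurable_funB.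
    - by apply: emeasurable_funD => //; case/integrableP: i2.
    - move=> x _; rewrite -EFinM -EFinD lee_fin /=.
      set y := f n.+1 x - f n x.
      have := sqr_ge0 (1 - t * `|y|).
      rewrite sqrrB expr1n mul1r exprMn -normrX [`|y ^+ 2|]ger0_norm ?sqr_ge0 // => h.
      rewrite -(ler_pM2l t0); have -> : t * (t^-1 / 2 + t / 2 * (y * y)) =
        (1 + t ^+ 2 * y ^+ 2) / 2 by field.
      by move: h; lra.
  rewrite integralD // integral_cst // integralZl //; last exact: L2_integrableM.
  rewrite integral_L2inner. rewrite -[X in (_ * X + _)%E]fineK ?fin_num_measure // -!EFinM -EFinD lee_fin.
  have := fc n n.+1 (leqnSn n); rewrite (_ : 4^-1 ^+ n = t^-1 ^+ 2); last first.
    by rewrite /t -!exprVn -exprM mulnC exprM; congr (_ ^+ n); field.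
  move=> h.
  have : t / 2 * L2inner (f n.+1 - f n) (f n.+1 - f n) <= t / 2 * (c * t^-1 ^+ 2).
    by rewrite ler_wpM2l // divr_ge0 // ltW.
  have -> : t / 2 * (c * t^-1 ^+ 2) = c / 2 / t by field.
  have -> : K / 2 ^+ n = t^-1 / 2 * fine (mu setT) + c / 2 / t by rewrite /K -/t; field.
  by lra.
have [N [mN muN Nf]] : {ae mu, forall x, cvgn (fun n => f n x)}.
  apply: ae_cvgn_of_sum => //.
  apply: (@le_lt_trans _ _ (\sum_(n <oo) (0 + (2 * K / (2 ^ n.+1)%:R)%:E))%E).
    apply: lee_nneseries => n _; first by move=> _; exact: integral_ge0.
    rewrite add0e natrX exprS invfM mulrA [2 * K]mulrC mulfK //; exact: step.
  apply: (le_lt_trans (@epsilon_trick _ (fun=> 0%E) _ xpredT _ _)) => //.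
    by rewrite mulr_ge0.
  by rewrite eseries0 // add0e ltry.
(* Setting the sequence to [0] on the exceptional set makes it converge everywhere, so that
   the limit is measurable. *)
pose g n x := f n x * \1_(~` N) x.
have cg x : cvgn (g ^~ x).
  rewrite /g indicE in_setC; case: (boolP (x \in N)) => xN /=.
    by under eq_fun do rewrite mulr0; exact: is_cvg_cst.
  under eq_fun do rewrite mulr1.
  apply: contrapT => nc; move/negP: xN; apply; apply/mem_set.
  exact: (Nf x nc).
pose G x := limn (g ^~ x).
have mg n : measurable_fun setT (g n).
  by apply: measurable_funM => //; apply: measurable_indic; exact: measurableC.
have mG : measurable_fun setT G by apply: (measurable_fun_cvg mg) => x _; exact: cg.
have mgf n m : measurable_fun setT (fun x => ((g m x - f n x) ^+ 2)%:E).
  by apply/measurable_EFinP; apply: measurable_funX; exact: measurable_funB.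
have gf m n : (n <= m)%N ->
    (\int[mu]_x ((g m x - f n x) ^+ 2)%:E <= (c * 4^-1 ^+ n)%:E)%E.
  move=> nm; rewrite (ge0_ae_eq_integral _ _ (g := fun x =>
    ((f m - f n) x * (f m - f n) x)%:E)) //.
  - by rewrite integral_L2inner lee_fin fc.
  - by case/integrableP: (L2_integrableM (f m - f n) (f m - f n)).
  - by move=> x _; rewrite lee_fin sqr_ge0.
  - by move=> x _; rewrite lee_fin -expr2 sqr_ge0.
  - exists N; split => // x; apply: contra_notP => xN _ /=.
    by rewrite /g indicE in_setC memNset //= mulr1 expr2.
have GF n : (\int[mu]_x ((G x - f n x) ^+ 2)%:E <= (c * 4^-1 ^+ n)%:E)%E.
  rewrite (eq_integral (fun x => limn_einf (fun m => ((g m x - f n x) ^+ 2)%:E))); last first.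
    move=> x _; apply/esym; apply: (cvg_limn_einf_sup _).1.
    apply: cvg_EFin; first exact: nearW.
    apply: cvgX; apply: cvgB; [exact: cg|exact: cvg_cst].
  apply: le_trans (fatou _ _ _ _) _ => //.
    by move=> m x _; rewrite lee_fin sqr_ge0.
  rewrite limn_einf_lim; apply: lime_le; first exact: is_cvg_einfs.
  apply: nearW => k; apply: le_trans (gf (maxn k n) n (leq_maxr k n)).
  by apply: ereal_inf_lbound; exists (maxn k n) => //=; exact: leq_maxl.
have [H HE _] := L2_of_sqr (measurable_funB mG (mf 0%N)) (GF 0%N).
exists (H + f 0%N) => n; rewrite -lee_fin -integral_L2inner.
apply: le_trans (GF n); rewrite le_eqVlt; apply/orP; left; apply/eqP.
apply: eq_integral => x _.
rewrite (_ : (H + f 0%N - f n) x = G x - f n x); first by rewrite expr2.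
by rewrite -[LHS]/(H x + f 0%N x - f n x) HE /= subrK.
Qed.

End L2_complete.

Section riesz.
Context d (T : measurableType d) (R : realType).
Variable mu : {finite_measure set T -> \bar R}.
Variables (L : L2 mu -> R) (K : R).
Hypothesis K0 : 0 <= K.
Hypothesis LP : forall (a : R) f g, L (a *: f + g) = a * L f + L g.
Hypothesis LK : forall f, L f ^+ 2 <= K * L2inner f f.

(** The functional whose minimiser represents [L]: its derivative at [f] in the direction
    [g] is [2 (<f, g> - L g)]. *)
Let J f := L2inner f f - 2 * L f.

Let LD f g : L (f + g) = L f + L g.
Proof. by have := LP 1 f g; rewrite scale1r mul1r. Qed.

Let L0 : L 0 = 0.
Proof. by have := LP 1 0 0; rewrite scale1r mul1r addr0 => h; lra. Qed.

Let LZ (a : R) f : L (a *: f) = a * L f.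
Proof. by have := LP a f 0; rewrite !addr0 L0 addr0. Qed.

Let J_lb f : - K <= J f.
Proof.
rewrite /J; set q := L2inner f f.
have q0 : 0 <= q by exact: L2inner_ge0.
have h := LK f; rewrite -/q in h.
rewrite leNgt; apply/negP => lt.
have p1 : 0 < 2 * L f - (q + K) by move: lt; rewrite -subr_gt0; lra.
have p2 : 0 < 2 * L f + (q + K) by move: K0; lra.
have := mulr_gt0 p1 p2.
have -> : (2 * L f - (q + K)) * (2 * L f + (q + K)) =
  4 * (L f ^+ 2) - 4 * (K * q) - (q - K) ^+ 2 by ring.
by have := sqr_ge0 (q - K); lra.
Qed.

(** By the parallelogram identity, near-minimisers of [J] are close to each other:
    minimising sequences are Cauchy. *)
Let J_parallelogram f g (i : R) : (forall h, i <= J h) ->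
  L2inner (f - g) (f - g) <= 2 * J f + 2 * J g - 4 * i.
Proof.
move=> iJ; have := iJ (2^-1 *: (f + g)); rewrite /J.
rewrite LZ LD L2innerZl L2innerZr !L2innerBl !L2innerBr !L2innerDl !L2innerDr.
by rewrite (L2innerC g f); lra.
Qed.

Theorem L2_riesz : exists xi, forall g, L2inner xi g = L g.
Proof.
pose S := range J.
have S0 : S !=set0 by exists (J 0); exists 0.
have Slb : has_inf S by split => //; exists (- K) => _ [f _ <-].
pose i := inf S.
have iJ f : i <= J f by apply: ge_inf; [exact: Slb.2|exists f].
have /choice[f fJ] (n : nat) : exists f, J f < i + 4^-1 ^+ n.
  have e0 : 0 < 4^-1 ^+ n :> R by exact: exprn_gt0.
  by have [_ [f _ <-] fi] := inf_adherent e0 Slb; exists f.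
have e_le n m : (n <= m)%N -> (4^-1 ^+ m : R) <= 4^-1 ^+ n.
  by move=> nm; apply: ler_wiXn2l => //; lra.
have [F FP] : exists F : L2 mu, forall n, L2inner (F - f n) (F - f n) <= 4 * 4^-1 ^+ n.
  apply: L2_fast_complete => n m nm.
  apply: (le_trans (J_parallelogram (f m) (f n) iJ)).
  by have := fJ n; have := fJ m; have := e_le n m nm; lra.
exists F => g.
(* Near-minimality of [f n] in the direction [g]; in the limit the quadratic polynomial
   in [a] is nonnegative, which forces its linear coefficient to vanish. *)
have quad n (a : R) : - (4^-1 ^+ n) <= 2 * a * (L2inner (f n) g - L g) + a ^+ 2 * L2inner g g.
  have := iJ (a *: g + f n); have := fJ n; rewrite /J LP.
  rewrite !L2innerDl !L2innerDr !L2innerZl !L2innerZr (L2innerC g (f n)).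
  by move=> h1 h2; nra.
have cF : L2inner (f n) g @[n --> \oo] --> L2inner F g.
  apply: (@squeeze_cvgr _ _ _ _
    (fun n => L2inner F g - (4 + L2inner g g) / 2 * 2^-1 ^+ n)
    (fun n => L2inner F g + (4 + L2inner g g) / 2 * 2^-1 ^+ n)).
  - apply: nearW => n; have t0 : 0 < 2 ^+ n :> R by exact: exprn_gt0.
    have := L2inner_young (F - f n) g t0; rewrite L2innerBl.
    have h4 : 2 ^+ n * L2inner (F - f n) (F - f n) <= 4 * 2^-1 ^+ n.
      apply: (le_trans (ler_wpM2l (ltW t0) (FP n))).
      rewrite mulrCA -exprMn_comm; last by exact: mulrC.
      by rewrite (_ : 2 * 4^-1 = 2^-1 :> R) //; field.
    rewrite -exprVn => h.
    have : `|L2inner F g - L2inner (f n) g| <= (4 + L2inner g g) / 2 * 2^-1 ^+ n by lra.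
    by rewrite ler_norml => /andP[? ?]; apply/andP; split; lra.
  - rewrite -[X in _ --> X]subr0; apply: cvgB; first exact: cvg_cst.
    rewrite -[X in _ --> X](mulr0 ((4 + L2inner g g) / 2)); apply: cvgMl_tmp.
    by apply: cvg_expr; rewrite ger0_norm; lra.
  - rewrite -[X in _ --> X]addr0; apply: cvgD; first exact: cvg_cst.
    rewrite -[X in _ --> X](mulr0 ((4 + L2inner g g) / 2)); apply: cvgMl_tmp.
    by apply: cvg_expr; rewrite ger0_norm; lra.
have quadF (a : R) : 0 <= 2 * a * (L2inner F g - L g) + a ^+ 2 * L2inner g g.
  have c4 : - (4^-1 ^+ n) @[n --> \oo] --> (0 : R).
    rewrite -oppr0; apply: cvgN.
    by apply: cvg_expr; rewrite ger0_norm; lra.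
  have cq : 2 * a * (L2inner (f n) g - L g) + a ^+ 2 * L2inner g g @[n --> \oo] -->
      2 * a * (L2inner F g - L g) + a ^+ 2 * L2inner g g.
    apply: cvgD; last exact: cvg_cst.
    by apply: cvgMl_tmp; apply: cvgB; [exact: cF|exact: cvg_cst].
  by apply: (ler_cvg_to c4 cq); exact: nearW.
apply/eqP; rewrite -subr_eq0; apply/eqP; set b := _ - _.
have q0 := L2inner_ge0 g; set q := L2inner g g in q0 quadF.
have q1 : 0 < q + 1 by lra.
(* Adding [1] to [q] avoids a case distinction on [q = 0]. *)
have := quadF (- b / (q + 1)).
have -> : 2 * (- b / (q + 1)) * b + (- b / (q + 1)) ^+ 2 * q =
  - (b ^+ 2 * (q + 2)) / (q + 1) ^+ 2 by field; lra.
rewrite mulNr oppr_ge0 => h.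
have : b ^+ 2 * (q + 2) <= 0.
  by move: h; rewrite pmulr_lle0 // invr_gt0 exprn_gt0.
rewrite pmulr_lle0; last by lra.
by move=> b2; apply/eqP; rewrite -sqrf_eq0; apply/eqP/le_anti; rewrite b2 sqr_ge0.
Qed.

End riesz.

(** * Covariance and exponential moments of the field *)
Section field.
Context d d' (T : measurableType d) (Omega : measurableType d') (R : realType).
Variables (nu : {finite_measure set T -> \bar R}) (P : probability Omega R).
Variable X : L2 nu -> L2 P.
Hypothesis gfX : gaussian_field X.
Implicit Types g h : L2 nu.

Lemma field_lin (a : R) g h : X (a *: g + h) = a *: X g + X h %[ae P].
Proof. by case: gfX. Qed.

Lemma field0 : X 0 = (0 : L2 P) %[ae P].
Proof.
have := field_lin 1 0 0; rewrite scale1r addr0.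
apply: filterS => w + _ => /(_ I).
by rewrite -[RHS]/(1 * X 0 w + X 0 w) -[X in _ -> X]/(X 0 w = 0); lra.
Qed.

Lemma fieldZ (a : R) g : X (a *: g) = a *: X g %[ae P].
Proof.
have := field_lin a g 0; rewrite addr0 => h1.
apply: filterS2 field0 h1 => w e0 e1 _; rewrite (e1 I).
by rewrite -[LHS]/(a * X g w + X 0 w) (e0 I); exact: addr0.
Qed.

Lemma field_linE (a : R) g h :
  {ae P, forall w, X (a *: g + h) w = a * X g w + X h w}.
Proof. by apply: filterS (field_lin a g h) => w /(_ I). Qed.

Lemma fieldZE (a : R) g : {ae P, forall w, X (a *: g) w = a * X g w}.
Proof. by apply: filterS (fieldZ a g) => w /(_ I). Qed.

Lemma L2inner_field_lin (eta : L2 P) (a : R) g h :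
  L2inner eta (X (a *: g + h)) = a * L2inner eta (X g) + L2inner eta (X h).
Proof. by rewrite (L2inner_aer _ (field_lin a g h)) L2innerDr L2innerZr. Qed.

Lemma field_bounded : exists2 K : R, 0 <= K &
  forall g, L2inner (X g) (X g) <= K * L2inner g g.
Proof.
have [_ [C CP] _] := gfX; exists (C ^+ 2); first exact: sqr_ge0.
move=> g; rewrite -lee_fin EFinM -!L2norm_sqr expr2.
rewrite [X in (_ <= X)%E](_ : _ = (C%:E * L2norm g) * (C%:E * L2norm g))%E; last first.
  by rewrite EFinM muleACA.
by apply: lee_pmul => //; exact: Lnorm_ge0.
Qed.

(** The covariance with [X(h)] is a bounded functional of [g], by the Cauchy-Schwarz
    inequality and the boundedness of [X]. *)
Lemma field_covariance_riesz h :
  exists xi, forall g, L2inner xi g = L2inner (X h) (X g).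
Proof.
have [K K0 XK] := field_bounded.
apply: (@L2_riesz _ _ _ _ _ (L2inner (X h) (X h) * K)).
- by rewrite mulr_ge0 // L2inner_ge0.
- by move=> a f g; exact: L2inner_field_lin.
- move=> f; apply: (le_trans (L2inner_cauchy_schwarz _ _)).
  by rewrite -mulrA ler_wpM2l // L2inner_ge0.
Qed.

Lemma closed_span_self h : closed_span X (X h).
Proof.
move=> e e0; exists 1%N, (fun=> 1), (fun=> h); rewrite big_ord1 scale1r subrr.
by rewrite /L2norm (_ : EFin \o _ = cst 0%E) // Lnorm0 // pnatr_eq0.
Qed.

Lemma field_exp h : (\int[P]_w (expR (X h w))%:E =
  (expR (2^-1 * L2inner (X h) (X h)))%:E)%E.
Proof.
by have [_ _ /(_ h) gX] := gfX; rewrite (gaussian_exp gX).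
Qed.

End field.

(** * The Cameron-Martin theorem *)
Section cameron_martin_theorem.
Context d d' (T : measurableType d) (Omega : measurableType d') (R : realType).
Variables (nu : {finite_measure set T -> \bar R}) (P : probability Omega R).
Variable X : L2 nu -> L2 P.
Hypothesis gfX : gaussian_field X.
Variables (I : countType) (g : I -> L2 nu).
Variables (h xi : L2 nu).
Hypothesis xiP : forall f, L2inner xi f = L2inner (X h) (X f).

Lemma measurable_Rproduct (phi : Omega -> Rproduct R I) :
  (forall i, measurable_fun setT (fun w => phi w i)) -> measurable_fun setT phi.
Proof.
move=> mphi; apply: (@measurability _ _ Omega (Rproduct R I) setT phi (@coordinate_sets R I) erefl).
move=> _ [_ [i _ [B mB <-]] <-]; rewrite !setTI.
by have := mphi i measurableT B mB; rewrite setTI.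
Qed.

Lemma measurable_coordinates : measurable_fun setT (coordinates X g).
Proof. exact: measurable_Rproduct. Qed.

Lemma measurable_shifted_coordinates : measurable_fun setT (shifted_coordinates X g xi).
Proof. by apply: measurable_Rproduct => i; exact: measurable_funD. Qed.

Let q := L2inner (X h) (X h).
Definition cameron_martin_density (w : Omega) : R := expR (X h w - 2^-1 * q).

Let measurable_density : measurable_fun setT cameron_martin_density.
Proof. by apply: measurableT_comp => //; exact: measurable_funB. Qed.

Let density_ge0 w : 0 <= cameron_martin_density w.
Proof. exact: expR_ge0. Qed.

Let m1 := weighted_law P (w := fun=> 1) (fun=> ler01) (measurable_cst (1 : R)) measurable_shifted_coordinates.
Let m2 := weighted_law P density_ge0 measurable_density measurable_coordinates.

(** The functions on the sequence space that read off some [X(h')] when evaluated at the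
    coordinates, and [X(h') + <xi, h'>] at the shifted coordinates.  It contains
    the coordinate functions, and the linearity of [X] makes it a vector space. *)
Let V : set (Rproduct R I -> R) := [set u | measurable_fun setT u /\
  exists h', u \o coordinates X g = X h' %[ae P] /\
    u \o shifted_coordinates X g xi = (fun w => X h' w + L2inner xi h') %[ae P]].

(** Both sides are Gaussian exponential moments.  Under the shift, [e^(a u)] has integral
    [exp (a <xi, h'> + a^2 E[X(h')^2] / 2)]; under the density, it has integral
    [exp (E[X(a h' + h)^2] / 2 - E[X(h)^2] / 2)]; these are equal because
    [<xi, h'> = E[X(h) X(h')]]. *)
Let V_exp u (a : R) : V u -> agree m1 m2 (fun x => expR (a * u x)).
Proof.
move=> [mu_ [h' [u1 u2]]].
have me : measurable_fun setT (fun x => expR (a * u x)).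
  by apply: measurableT_comp => //; exact: measurable_funM.
have mE : measurable_fun setT (fun x => (expR (a * u x))%:E) by exact/measurable_EFinP.
have mX f : measurable_fun setT (fun w => (expR (X f w))%:E).
  by apply/measurable_EFinP; exact: measurableT_comp.
have iX f : P.-integrable setT (fun w => (expR (X f w))%:E).
  apply/integrableP; split => //.
  under eq_integral do rewrite gee0_abs ?lee_fin ?expR_ge0 //.
  by rewrite field_exp // ltry.
apply: (@agree_ge0 _ _ _ _ _ _ (expR (a * L2inner xi h' +
   2^-1 * (a ^+ 2 * L2inner (X h') (X h'))))) => //.
- rewrite ge0_integral_weighted_law //.
  transitivity (\int[P]_w ((expR (a * L2inner xi h'))%:E * (expR (X (a *: h') w))%:E))%E.
    apply: ae_eq_integral => //.
    - apply: emeasurable_funM => //.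
      by apply: (measurableT_comp mE); exact: measurable_shifted_coordinates.
    - exact: emeasurable_funM.
    - apply: filterS2 u2 (fieldZE gfX a h') => w /(_ Logic.I) /= -> -> _.
      by rewrite mul1e -EFinM -expRD mulrDr addrC.
  rewrite integralZl // field_exp // -EFinM -expRD; congr (expR (_ + _ * _))%:E.
  by rewrite (L2inner_aer _ (fieldZ gfX _ _)) (L2inner_aerl _ (fieldZ gfX _ _)) L2innerZl L2innerZr mulrA.
- rewrite ge0_integral_weighted_law //.
  transitivity (\int[P]_w ((expR (- (2^-1 * q)))%:E * (expR (X (a *: h' + h) w))%:E))%E.
    apply: ae_eq_integral => //.
    - apply: emeasurable_funM => //; first exact/measurable_EFinP.
      by apply: (measurableT_comp mE); exact: measurable_coordinates.
    - exact: emeasurable_funM.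
    - apply: filterS2 u1 (field_linE gfX a h' h) => w /(_ Logic.I) /= -> -> _.
      rewrite -!EFinM -!expRD.
      by congr (expR _)%:E; ring.
  rewrite integralZl // field_exp // -EFinM -expRD; congr (expR _)%:E.
  rewrite L2inner_field_lin // !(L2innerC (X (a *: h' + h))) !L2inner_field_lin //.
  by rewrite xiP (L2innerC (X h') (X h)) /q; field.
Qed.

Lemma shifted_law E : measurable E -> m1 E = m2 E.
Proof.
move=> mE; apply: (@trigonometric_uniqueness _ _ _ m1 m2 V).
- by move=> u [].
- split; [exact: measurable_cst|exists 0; split].
    by apply: filterS (field0 gfX) => w + _ => /(_ Logic.I) /= ->.
  apply: filterS (field0 gfX) => w + _ => /(_ Logic.I) /= ->.
  by rewrite -(scale0r (0 : L2 nu)) L2innerZr mul0r addr0.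
- move=> u v [mu_ [hu [u1 u2]]] [mv [hv [v1 v2]]]; split; first exact: measurable_funD.
  have hX := field_linE gfX 1 hu hv.
  exists (1 *: hu + hv); split.
    apply: filterS3 u1 v1 hX => w /(_ Logic.I) /= -> /(_ Logic.I) /= -> -> _.
    by rewrite mul1r.
  apply: filterS3 u2 v2 hX => w /(_ Logic.I) /= -> /(_ Logic.I) /= -> -> _.
  by rewrite L2innerDr L2innerZr; ring.
- move=> a u [mu_ [hu [u1 u2]]]; split; first exact: measurable_funM.
  have hX := fieldZE gfX a hu.
  exists (a *: hu); split.
    by apply: filterS2 u1 hX => w /(_ Logic.I) /= -> -> _.
  apply: filterS2 u2 hX => w /(_ Logic.I) /= -> -> _.
  by rewrite L2innerZr mulrDr.
- by move=> u Vu; apply: agree_cos => a; exact: V_exp.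
- by move=> u Vu; apply: agree_sin => a; exact: V_exp.
- move: mE; apply: sub_smallest2r; first exact: smallest_sigma_algebra.
  move=> _ [i _ [B mB <-]]; exists (fun x => x i); last by exists B.
  split; last by exists (g i); split; exact: aeW.
  move=> _ C mC; apply: sub_sigma_algebra; exists i => //; by exists C.
Qed.

Theorem cameron_martin_shift (F : Rproduct R I -> \bar R) :
  (forall x, 0 <= F x)%E -> measurable_fun setT F ->
  (\int[P]_w F (shifted_coordinates X g xi w) =
   \int[P]_w ((cameron_martin_density w)%:E * F (coordinates X g w)))%E.
Proof.
move=> F0 mF.
rewrite -(ge0_integral_weighted_law P density_ge0 measurable_density measurable_coordinates) //.
rewrite -/m2 -(eq_measure_integral _ (fun A mA _ => shifted_law mA)).
by rewrite ge0_integral_weighted_law //; apply: eq_integral => w _; rewrite mul1e.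
Qed.

End cameron_martin_theorem.

(** * The measures with density M(A) *)
Section rooted.
Context d d' (T : measurableType d) (Omega : measurableType d') (R : realType).
Variables (P : probability Omega R).
Implicit Types M : R.-ftker Omega ~> T.

Lemma ftker_fineK M w A : measurable A -> (fine (M w A))%:E = M w A.
Proof. by move=> mA; rewrite fineK //; exact: kernel_finite_transition. Qed.

Lemma measurable_fine_kernel M A : measurable A -> measurable_fun setT (fun w => fine (M w A)).
Proof.
move=> mA; apply: (measurableT_comp (@fine_measurable R setT measurableT)).
exact: measurable_kernel.
Qed.

(** The measure [M(A) P] on [Omega]; when [M] has mean [mu] it is, up to a constant, the
    law of the randomness under the Peyriere measure, given that the random root lies
    in [A]. *)
Definition rooted M A (mA : measurable A) : {measure set Omega -> \bar R} :=
  weighted_law P (fun w => fine_ge0 (measure_ge0 (M w) A))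
    (measurable_fine_kernel M mA) (@measurable_id _ _ setT).

Lemma ge0_integral_rooted M A (mA : measurable A) (f : Omega -> \bar R) :
  (forall w, 0 <= f w)%E -> measurable_fun setT f ->
  (\int[rooted M mA]_w f w = \int[P]_w (M w A * f w))%E.
Proof.
move=> f0 mf; rewrite ge0_integral_weighted_law //.
by apply: eq_integral => w _; rewrite ftker_fineK.
Qed.

(** For bounded [f], the variables [M(B n) f] are dominated by [M(A)], which has finite
    mean. *)
Lemma agree_rooted_limit M M' A (mA : measurable A) (B : nat -> set T)
    (mB : forall n, measurable (B n)) (f : Omega -> R) :
  (\int[P]_w M w A < +oo)%E -> (\int[P]_w M' w A < +oo)%E ->
  {homo B : n m / (n <= m)%N >-> (n <= m)%O} -> \bigcup_n B n = A ->
  measurable_fun setT f -> (forall w, `|f w| <= 1) ->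
  (forall n, agree (rooted M (mB n)) (rooted M' (mB n)) f) ->
  agree (rooted M mA) (rooted M' mA) f.
Proof.
move=> Mfin M'fin ndB BA mf f1 af.
have sub (N : R.-ftker Omega ~> T) : (\int[P]_w N w A < +oo)%E ->
    (rooted N mA).-integrable setT (EFin \o f) /\
    (\int[rooted N (mB n)]_w (f w)%:E)%E @[n --> \oo] --> (\int[rooted N mA]_w (f w)%:E)%E.
  move=> Nfin.
  have iN : P.-integrable setT (fun w => (fine (N w A))%:E).
    apply/integrableP; split; first exact/measurable_EFinP/measurable_fine_kernel.
    rewrite (eq_integral (fun w => N w A)) // => w _.
    by rewrite gee0_abs ?lee_fin ?fine_ge0 // ftker_fineK.
  have mg n : measurable_fun setT (fun w => (fine (N w (B n)) * f w)%:E).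
    by apply/measurable_EFinP; apply: measurable_funM => //; exact: measurable_fine_kernel.
  have mg' : measurable_fun setT (fun w => (fine (N w A) * f w)%:E).
    by apply/measurable_EFinP; apply: measurable_funM => //; exact: measurable_fine_kernel.
  have cv w : fine (N w (B n)) * f w @[n --> \oo] --> fine (N w A) * f w.
    apply: cvgMr_tmp; apply: fine_cvg; rewrite ftker_fineK // -BA.
    by apply: nondecreasing_cvg_mu => //; rewrite BA.
  have bd n w : `|fine (N w (B n)) * f w| <= fine (N w A).
    rewrite normrM ger0_norm ?fine_ge0 // -[leRHS]mulr1.
    apply: ler_pM => //.
    rewrite -lee_fin !ftker_fineK //; apply: le_measure; rewrite ?inE //.
    by rewrite -BA; exact: bigcup_sup.
  have [i _ l] : [/\ P.-integrable setT (fun w => (fine (N w A) * f w)%:E),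
      [sequence \int[P]_w `|(fine (N w (B n)) * f w)%:E - (fine (N w A) * f w)%:E|]_n
        @ \oo --> 0 &
      [sequence \int[P]_w (fine (N w (B n)) * f w)%:E]_n @ \oo -->
        \int[P]_w (fine (N w A) * f w)%:E]%E.
    apply: (dominated_convergence measurableT mg mg' _ iN).
    - by apply: aeW => w _; apply: cvg_EFin; [exact: nearW|exact: cv].
    - by apply: aeW => w n _; rewrite lee_fin.
  split; first exact/integrable_weighted_law.
  rewrite integral_weighted_law //; apply: cvg_trans l; apply: near_eq_cvg.
  by apply: nearW => n; rewrite integral_weighted_law.
have [i1 l1] := sub M Mfin; have [i2 l2] := sub M' M'fin.
split; [exact: i1|exact: i2|].
have E : (fun n => \int[rooted M (mB n)]_w (f w)%:E)%E =
    (fun n => \int[rooted M' (mB n)]_w (f w)%:E)%E.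
  by apply/funext => n; case: (af n).
by rewrite E in l1; exact: (cvg_unique _ l1 l2).
Qed.

End rooted.

(** * Exponential moments of a chaos and uniqueness on a fixed set *)
Section chaos_exponential.
Context d d' (T : measurableType d) (Omega : measurableType d') (R : realType).
Variables (mu : {finite_measure set T -> \bar R}) (P : probability Omega R).
Variables (nu : {finite_measure set T -> \bar R}) (X : L2 nu -> L2 P).
Hypothesis gfX : gaussian_field X.
Variables (I : countType) (g : I -> L2 nu).

Lemma integral_mean_measure (M : R.-ftker Omega ~> T) (f : T -> \bar R) A :
  (forall B, measurable B -> mean_measure P M B = mu B) ->
  measurable A -> (forall t, 0 <= f t)%E -> measurable_fun setT f ->
  (\int[P]_w \int[M w]_(t in A) f t = \int[mu]_(t in A) f t)%E.
Proof.
move=> meanM mA f0 mf.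
have fA0 t : (0 <= (f \_ A) t)%E by rewrite patchE; case: ifP.
have mfA : measurable_fun setT (f \_ A).
  by apply/(measurable_restrictT f mA); exact: measurable_funTS.
under eq_integral do rewrite integral_mkcond.
rewrite -(integral_mixture P M fA0 mfA) [RHS]integral_mkcond.
by apply: eq_measure_integral => B mB _; exact: meanM.
Qed.

(** The Cameron-Martin theorem is applied to the functional [y |-> m y A]: its value at
    the shifted coordinates is the integral of [e^xi] over [A] against [M], whose
    mean is an integral against [mu]. *)
Lemma chaos_exponential (M : R.-ftker Omega ~> T) h xi A :
  GMC mu X g M -> (forall B, measurable B -> mean_measure P M B = mu B) ->
  (forall f, L2inner xi f = L2inner (X h) (X f)) -> measurable A ->
  (\int[P]_w (M w A * (expR (X h w))%:E) =
   (expR (2^-1 * L2inner (X h) (X h)))%:E * \int[mu]_(t in A) (expR (xi t))%:E)%E.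
Proof.
move=> [_ _ [m mM mshift]] meanM xiP mA.
have cmxi : cameron_martin X xi by exists (X h) => //; exact: closed_span_self.
have me : measurable_fun setT (fun t => (expR (xi t))%:E).
  by apply/measurable_EFinP; exact: measurableT_comp.
have mmA : measurable_fun setT (fun y => m y A) by exact: measurable_kernel.
have mX : measurable_fun setT (fun w => (expR (X h w))%:E).
  by apply/measurable_EFinP; exact: measurableT_comp.
have := cameron_martin_shift gfX g xiP (fun y => measure_ge0 (m y) A) mmA.
rewrite (ae_eq_integral (fun w => \int[M w]_(t in A) (expR (xi t))%:E)%E) //; first last.
- by apply: filterS (mshift xi cmxi) => w + _; exact.
- under eq_fun do rewrite integral_mkcond.
  apply: measurable_fun_integral_kernel; first exact: measurable_kernel.
    by move=> t; rewrite patchE; case: ifP => _ //; rewrite lee_fin expR_ge0.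
  by apply/(measurable_restrictT _ mA); exact: measurable_funTS.
- by apply: (measurableT_comp mmA); exact: measurable_shifted_coordinates.
rewrite integral_mean_measure // => ->.
have mMX : measurable_fun setT (fun w => M w A * (expR (X h w))%:E)%E.
  by apply: emeasurable_funM => //; exact: measurable_kernel.
have mdm : measurable_fun setT
    (fun w => (cameron_martin_density X h w)%:E * m (coordinates X g w) A)%E.
  apply: emeasurable_funM.
    by apply/measurable_EFinP; apply: measurableT_comp => //; exact: measurable_funB.
  by apply: (measurableT_comp mmA); exact: measurable_coordinates.
rewrite -(ge0_integralZl _ measurableT mdm) //; last first.
  by move=> w _; rewrite mule_ge0 // lee_fin expR_ge0.
apply: ae_eq_integral => //; first exact: measurable_funeM.
apply: filterS mM => w mw _; rewrite (mw A mA) muleA -EFinM -expRD muleC.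
by congr ((expR _)%:E * _)%E; ring.
Qed.

(** The bound on [xi] makes the common value of the exponential moments finite for all
    multiples of [h]. *)
Lemma agree_rooted_exp (M M' : R.-ftker Omega ~> T) A (mA : measurable A) h xi (K : R)
    (u : Omega -> R) :
  GMC mu X g M -> (forall B, measurable B -> mean_measure P M B = mu B) ->
  GMC mu X g M' -> (forall B, measurable B -> mean_measure P M' B = mu B) ->
  (forall f, L2inner xi f = L2inner (X h) (X f)) ->
  (forall t, A t -> `|xi t| <= K) ->
  measurable_fun setT u -> u = X h %[ae P] ->
  forall a : R, agree (rooted P M mA) (rooted P M' mA) (fun w => expR (a * u w)).
Proof.
move=> gM eM gM' eM' xiP xiK mu_ uX a.
pose c := ((expR (2^-1 * L2inner (X (a *: h)) (X (a *: h))))%:E *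
   \int[mu]_(t in A) (expR ((a *: xi) t))%:E)%E.
have axiP f : L2inner (a *: xi) f = L2inner (X (a *: h)) (X f).
  by rewrite L2innerZl xiP (L2inner_aerl _ (fieldZ gfX a h)) L2innerZl.
have meu : measurable_fun setT (fun w => expR (a * u w)).
  by apply: measurableT_comp => //; exact: measurable_funM.
have E (N : R.-ftker Omega ~> T) : GMC mu X g N ->
    (forall B, measurable B -> mean_measure P N B = mu B) ->
    (\int[rooted P N mA]_w (expR (a * u w))%:E = c)%E.
  move=> gN eN; rewrite ge0_integral_rooted; last 2 first.
  - by move=> w; rewrite lee_fin expR_ge0.
  - exact/measurable_EFinP.
  rewrite /c -(chaos_exponential gN eN axiP mA); apply: ae_eq_integral => //.
  - by apply: emeasurable_funM; [exact: measurable_kernel|exact/measurable_EFinP].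
  - apply: emeasurable_funM; first exact: measurable_kernel.
    by apply/measurable_EFinP; exact: measurableT_comp.
  - by apply: filterS2 uX (fieldZE gfX a h) => w /(_ Logic.I) -> -> _.
have mexi : measurable_fun setT (fun t => (expR ((a *: xi) t))%:E).
  by apply/measurable_EFinP; exact: measurableT_comp.
have cfin : c \is a fin_num.
  rewrite /c fin_numM // ge0_fin_numE; last first.
    by apply: integral_ge0 => t _; rewrite lee_fin expR_ge0.
  apply: (@le_lt_trans _ _ (\int[mu]_(t in A) (expR (`|a| * K))%:E)%E).
    apply: ge0_le_integral => //.
    - exact: (measurable_funTS mexi).
    - move=> t At; rewrite lee_fin ler_expR.
      apply: (le_trans (ler_norm _)); rewrite normrM; apply: ler_wpM2l => //.
      exact: xiK.
  by rewrite integral_cst // lte_mul_pinfty ?lee_fin ?expR_ge0 // -ge0_fin_numE // fin_num_measure.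
apply: (@agree_ge0 _ _ _ _ _ _ (fine c)) => //; rewrite fineK //; exact: E.
Qed.

Lemma agree_rooted_trig (M M' : R.-ftker Omega ~> T) A (mA : measurable A) h
    (u : Omega -> R) :
  GMC mu X g M -> (forall B, measurable B -> mean_measure P M B = mu B) ->
  GMC mu X g M' -> (forall B, measurable B -> mean_measure P M' B = mu B) ->
  measurable_fun setT u -> u = X h %[ae P] ->
  agree (rooted P M mA) (rooted P M' mA) (cos \o u) /\
  agree (rooted P M mA) (rooted P M' mA) (sin \o u).
Proof.
move=> gM eM gM' eM' mu_ uX.
have [xi xiP] := field_covariance_riesz gfX h.
pose B n := A `&` [set t | `|xi t| <= n%:R].
have mB n : measurable (B n).
  apply: measurableI => //.
  have mx : measurable_fun setT (fun t => `|xi t|) by exact: measurableT_comp.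
  rewrite (_ : [set t | _] = setT `&` (fun t => `|xi t|) @^-1` `]-oo, n%:R]).
    by apply: mx => //; exact: measurable_itv.
  by rewrite setTI; apply/seteqP; split => t /=; rewrite in_itv.
have ndB : {homo B : n m / (n <= m)%N >-> (n <= m)%O}.
  move=> n m nm; apply/subsetPset; apply: setIS => t /= h1; apply: (le_trans h1).
  by rewrite ler_nat.
have BA : \bigcup_n B n = A.
  apply/seteqP; split => [t [n _ []] //|t At].
  exists (Num.bound `|xi t|) => //; split => //=.
  by apply/ltW/archi_boundP.
have finM (N : R.-ftker Omega ~> T) :
    (forall B, measurable B -> mean_measure P N B = mu B) -> (\int[P]_w N w A < +oo)%E.
  by move=> eN; rewrite -/(mean_measure P N A) eN // -ge0_fin_numE // fin_num_measure.
have trunc n a : agree (rooted P M (mB n)) (rooted P M' (mB n)) (fun w => expR (a * u w)).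
  by apply: (agree_rooted_exp (mB n) (K := n%:R) gM eM gM' eM' xiP) => // t [].
split.
- apply: (@agree_rooted_limit _ _ _ _ _ P M M' A mA B mB (cos \o u) (finM M eM) (finM M' eM') ndB BA).
  + by apply: measurableT_comp => //; apply: continuous_measurable_fun; exact: continuous_cos.
  + by move=> w; rewrite /= ler_norml cos_geN1 cos_le1.
  + by move=> n; exact: agree_cos.
- apply: (@agree_rooted_limit _ _ _ _ _ P M M' A mA B mB (sin \o u) (finM M eM) (finM M' eM') ndB BA).
  + by apply: measurableT_comp => //; apply: continuous_measurable_fun; exact: continuous_sin.
  + by move=> w; rewrite /= ler_norml sin_geN1 sin_le1.
  + by move=> n; exact: agree_sin.
Qed.

(** All measurable functions almost surely equal to some [X(h)]: the sigma-algebra that they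
    generate contains the measurable null sets, since the indicator of such a set is a
    version of [X(0)]; it therefore absorbs the completion. *)
Definition field_versions : set (Omega -> R) :=
  [set u | measurable_fun setT u /\ exists h, u = X h %[ae P]].

Definition field_events : set (set Omega) :=
  <<s \bigcup_(u in field_versions) preimage_set_system setT u measurable >>.

Lemma rooted_field_events (M M' : R.-ftker Omega ~> T) A (mA : measurable A) E :
  GMC mu X g M -> (forall B, measurable B -> mean_measure P M B = mu B) ->
  GMC mu X g M' -> (forall B, measurable B -> mean_measure P M' B = mu B) ->
  field_events E -> rooted P M mA E = rooted P M' mA E.
Proof.
move=> gM eM gM' eM'; apply: trigonometric_uniqueness.
- by move=> u [].
- split; first exact: measurable_cst.
  by exists 0; apply: filterS (field0 gfX) => w /[apply] ->.
- move=> u v [mu_ [hu u1]] [mv [hv v1]]; split; first exact: measurable_funD.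
  exists (1 *: hu + hv).
  apply: filterS3 u1 v1 (field_linE gfX 1 hu hv) => w /(_ Logic.I) + /(_ Logic.I) + + _.
  by move=> /= -> -> ->; rewrite mul1r.
- move=> a u [mu_ [hu u1]]; split; first exact: measurable_funM.
  exists (a *: hu).
  by apply: filterS2 u1 (fieldZE gfX a hu) => w /(_ Logic.I) -> -> _.
- by move=> u [mu_ [h uX]]; case: (agree_rooted_trig mA gM eM gM' eM' mu_ uX).
- by move=> u [mu_ [h uX]]; case: (agree_rooted_trig mA gM eM gM' eM' mu_ uX).
Qed.

Lemma field_events_null N : measurable N -> P N = 0%E -> field_events N.
Proof.
move=> mN PN; apply: sub_sigma_algebra; exists (\1_N : Omega -> R).
  split; first exact: measurable_indic.
  have nN : {ae P, forall w, ~ N w} by exists N; split => // w /= /contrapT.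
  exists 0; apply: filterS2 (field0 gfX) nN => w X0w Nw _.
  by rewrite (X0w Logic.I) indicE memNset.
exists [set 1]; first exact: measurable_set1.
rewrite setTI; apply/seteqP; split => w /=; rewrite indicE.
  by case: (boolP (w \in N)) => [/set_mem //|_ /= /eqP]; rewrite eq_sym oner_eq0.
by move=> Nw; rewrite mem_set.
Qed.

(** If [N] is a null set covering the symmetric difference of [B] and [B0], then [B] is
    [B0] minus [N], together with the null set [B] intersected with [N]. *)
Lemma field_events_completion B : measurable B -> sigma_field X B -> field_events B.
Proof.
move=> mB [B0 sB0 [N [mN PN BN]]].
have fB0 : field_events B0.
  move: B0 sB0 {BN}; apply: sub_smallest2r; first exact: smallest_sigma_algebra.
  move=> _ [h _ [C mC <-]]; exists (X h); last by exists C.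
  by split => //; exists h; exact: aeW.
have fN := field_events_null mN PN.
have fBN : field_events (B `&` N).
  apply: field_events_null; first exact: measurableI.
  apply/eqP; rewrite eq_le measure_ge0 andbT -PN.
  by apply: le_measure; rewrite ?inE //; exact: measurableI.
pose gen := \bigcup_(u in field_versions) preimage_set_system setT u measurable.
rewrite (_ : B = (B0 `\` N) `|` (B `&` N)).
  apply: (@measurableU _ (g_sigma_algebraType gen)) => //.
  exact: (@measurableD _ (g_sigma_algebraType gen)).
apply/seteqP; split => w.
  move=> Bw; have [Nw|Nw] := pselect (N w); first by right.
  left; split => //; apply: contrapT => nB0; apply: Nw; apply: BN.
  by left.
move=> [[B0w Nw]|[]//]; apply: contrapT => nB; apply: Nw; apply: BN.
by right.
Qed.

Lemma measurable_field_kernel (M : R.-ftker Omega ~> T) A : measurable A ->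
  field_measurable X M ->
  @measurable_fun _ _ (g_sigma_algebraType
    (\bigcup_(u in field_versions) preimage_set_system setT u measurable)) _
    setT (fun w => M w A).
Proof.
move=> mA fM _ B mB; rewrite setTI; apply: field_events_completion.
  by have := measurable_kernel M A mA measurableT B mB; rewrite setTI.
exact: fM.
Qed.

(** The event [M(A) < M'(A)] belongs to the field, so [M(A)] and [M'(A)] have the same
    integral over it, and it must be null. *)
Lemma chaos_ae_le (M M' : R.-ftker Omega ~> T) A : measurable A ->
  GMC mu X g M -> (forall B, measurable B -> mean_measure P M B = mu B) ->
  GMC mu X g M' -> (forall B, measurable B -> mean_measure P M' B = mu B) ->
  {ae P, forall w, (M' w A <= M w A)%E}.
Proof.
move=> mA gM eM gM' eM'.
have [_ fM _] := gM; have [_ fM' _] := gM'.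
pose E := [set w | (M w A < M' w A)%E].
have fE : field_events E.
  rewrite -(setTI E); apply: (@measurable_lte _ (g_sigma_algebraType
    (\bigcup_(u in field_versions) preimage_set_system setT u measurable))) => //;
    exact: measurable_field_kernel.
have mE : measurable E.
  by rewrite -(setTI E); apply: measurable_lte => //; exact: measurable_kernel.
have finM (N : R.-ftker Omega ~> T) :
    (forall B, measurable B -> mean_measure P N B = mu B) ->
    P.-integrable setT (fun w => (fine (N w A) * \1_E w)%:E).
  move=> eN; apply: (@le_integrable _ _ _ P setT measurableT _ (fun w => (fine (N w A))%:E)).
  - apply/measurable_EFinP; apply: measurable_funM; first exact: measurable_fine_kernel.
    exact: measurable_indic.
  - move=> w _; rewrite lee_fin normrM -[leRHS]mulr1 ler_wpM2l // indicE.
    by case: (_ \in _); rewrite /= ?normr1 ?normr0.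
  - apply/integrableP; split; first exact/measurable_EFinP/measurable_fine_kernel.
    rewrite (eq_integral (fun w => N w A)) => [|w _]; last first.
      by rewrite gee0_abs ?lee_fin ?fine_ge0 // ftker_fineK.
    by rewrite -/(mean_measure P N A) eN // -ge0_fin_numE // fin_num_measure.
have := rooted_field_events mA gM eM gM' eM' fE.
rewrite !weighted_lawE // => eqE.
pose f w := ((fine (M' w A) * \1_E w)%:E - (fine (M w A) * \1_E w)%:E)%E.
have f0 w : (0 <= f w)%E.
  rewrite /f -EFinB lee_fin -mulrBl indicE; case: (boolP (w \in E)) => [|_]; last by rewrite mulr0.
  rewrite inE /E /= mulr1 subr_ge0 -lee_fin !ftker_fineK //; exact: ltW.
have intf : (\int[P]_w `|f w| = 0)%E.
  rewrite (eq_integral f) => [|w _]; last by rewrite gee0_abs.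
  rewrite integralB //; [|exact: finM|exact: finM].
  under eq_integral do rewrite EFinM.
  under [X in (_ - X)%E]eq_integral do rewrite EFinM.
  rewrite -eqE subee // integrable_fin_num //.
  under eq_fun do rewrite -EFinM; exact: finM.
have mf : measurable_fun setT f.
  by apply: emeasurable_funB; [case/integrableP: (finM M' eM')|case/integrableP: (finM M eM)].
move/(ae_eq_integral_abs P measurableT mf) : intf; apply: filterS => w /(_ Logic.I) fw.
rewrite leNgt; apply/negP => Ew; move: fw; rewrite /f indicE mem_set //= !mulr1 -EFinB.
move=> [/eqP]; rewrite subr_eq0 => /eqP e; move: Ew.
by rewrite -[M w A]ftker_fineK // -[M' w A]ftker_fineK // e ltxx.
Qed.

End chaos_exponential.

(** * Reduction to countably many sets *)
Section standard.
Context (R : realType) d (T : measurableType d).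
Variable f : {mfun T >-> R}.
Hypothesis f_inj : injective f.
Hypothesis f_img : forall A, measurable A -> measurable (f @` A).

Definition ray (q : rat) : set T := f @^-1` `]-oo, ratr q[.

Lemma measurable_ray q : measurable (ray q).
Proof. by rewrite /ray -[X in measurable X]setTI; exact: measurable_funP. Qed.

(** By injectivity [A] is the preimage of its image, which is a Borel set of the line. *)
Lemma standard_measurable_rays A : measurable A -> <<s range ray >> A.
Proof.
move=> mA.
have -> : A = f @^-1` (f @` A).
  apply/seteqP; split => [t At|t [s As /f_inj <-]] //; by exists t.
have : <<s @RGenInftyO.G R >> (f @` A).
  have : (@RGenInftyO.G R).-sigma.-measurable (f @` A).
    by rewrite -RGenInftyO.measurableE; exact: f_img.
  by [].
apply: (@smallest_sub _ _ _ [set B | <<s range ray >> (f @^-1` B)]).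
  have [h0 hC hU] := smallest_sigma_algebra [set: T] (range ray); split => /=.
  - by rewrite preimage_set0.
  - by move=> B /hC; rewrite !setTD preimage_setC.
  - by move=> B hB; rewrite preimage_bigcup; exact: hU.
move=> _ [x ->] /=.
rewrite (_ : f @^-1` _ = \bigcup_(q : rat) (if (ratr q <= x) then ray q else set0)).
  apply: (@bigcupT_measurable_rat _ (g_sigma_algebraType (range ray))) => q.
  by case: ifP => _; [apply: sub_sigma_algebra; exists q|exact: measurable0].
apply/seteqP; split => t /=.
  rewrite in_itv /= => ftx; have [q] := rat_in_itvoo ftx; rewrite in_itv /= => /andP[fq qx].
  by exists q => //; rewrite (ltW qx) /ray /= in_itv.
move=> [q _]; case: ifP => // qx; rewrite /ray /= !in_itv /= => ftq.
exact: lt_le_trans qx.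
Qed.

Lemma measure_eq_rays (m1 m2 : {measure set T -> \bar R}) :
  (m1 setT < +oo)%E -> (forall q, m1 (ray q) = m2 (ray q)) ->
  forall A, measurable A -> m1 A = m2 A.
Proof.
move=> fin eq_ray A /standard_measurable_rays.
apply: (g_sigma_algebra_measure_unique (range ray) _ (fun n => ray n%:R)).
- by move=> _ [q _ <-]; exact: measurable_ray.
- by move=> n; exists n%:R.
- apply/seteqP; split => // t _; exists (Num.bound `|f t|) => //.
  rewrite /ray /= in_itv /= ratr_nat; apply: (le_lt_trans (ler_norm _)).
  exact: archi_boundP.
- move=> _ _ [q _ <-] [r _ <-].
  wlog qr : q r / q <= r.
    move=> h; have [/h //|/ltW/h] := leP q r; by rewrite setIC.
  exists q => //; apply/esym/setIidPl => t; rewrite /ray /= !in_itv /= => ftq.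
  by apply: (lt_le_trans ftq); rewrite ler_rat.
- by move=> _ [q _ <-].
- move=> k; apply: le_lt_trans fin; apply: le_measure; rewrite ?inE //.
  exact: measurable_ray.
Qed.

End standard.

Theorem corollary5 (R : realType) (d d' : measure_display)
    (T : measurableType d) (Omega : measurableType d')
    (mu : {finite_measure set T -> \bar R}) (P : probability Omega R)
    (stdT : standard_measurable R T) (stdP : standard_probability P)
    (nu : {finite_measure set T -> \bar R})
    (numu : nu `<< mu) (munu : mu `<< nu)
    (X : L2 nu -> L2 P) (gfX : gaussian_field X)
    (I : countType) (g : I -> L2 nu) (onb_g : orthonormal_basis g)
    (M M' : R.-ftker Omega ~> T)
    (gmcM : GMC mu X g M) (subM : subcritical P M)
    (gmcM' : GMC mu X g M') (subM' : subcritical P M')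
    (meanM : forall A, measurable A -> mean_measure P M A = mu A)
    (meanM' : forall A, measurable A -> mean_measure P M' A = mu A) :
  {ae P, forall w, forall A, measurable A -> M w A = M' w A}.
Proof.
have [f [f_inj f_img]] := stdT.
have eqA A : measurable A -> {ae P, forall w, M w A = M' w A}.
  move=> mA; apply: filterS2 (chaos_ae_le gfX mA gmcM meanM gmcM' meanM')
    (chaos_ae_le gfX mA gmcM' meanM' gmcM meanM) => w le1 le2.
  by apply/le_anti; rewrite le1 le2.
(* The rays are enumerated through the encoding of rationals as natural numbers. *)
have : {ae P, forall w, forall n : nat, if unpickle n is Some q then
    M w (ray f q) = M' w (ray f q) else True}.
  apply: ae_foralln => n; case: (unpickle n) => [q|]; last exact: aeW.
  by apply: eqA; exact: measurable_ray.
apply: filterS => w eq_ray; apply: (measure_eq_rays f_inj f_img).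
  by rewrite -ge0_fin_numE // kernel_finite_transition.
by move=> q; have := eq_ray (pickle q); rewrite pickleK.
Qed.
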